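(* (In $\mathbf{ZF}$.) Let $\mathbf{X}$ be a locally compact Hausdorff space which has a cuf base, and let $P$ be a $G_\delta$-subset of $\mathbf{X}$. Then the subspace $\mathbf{P}$ of $\mathbf{X}$ with underlying set $P$ is Cantor completely metrizable.
   Context: The result is a theorem of $\mathbf{ZF}$ (Zermelo–Fraenkel set theory without the axiom of choice). A set is countable if it is equipotent with a subset of $\omega$. A set is a cuf set if it is expressible as a countable union of finite sets. A topological space has a cuf base if it has an open base which is a cuf set. For a metric $d$ on $X$, $\tau(d)$ is the topology induced by $d$ and $\delta_d(A)=\sup\{d(x,y):x,y\in A\}$. A metric $d$ on $X$ is Cantor complete if, for every descending family $\{F_n:n\in\omega\}$ of non-empty closed subsets of $\langle X,\tau(d)\rangle$ with $\lim_{n\to+\infty}\delta_d(F_n)=0$, we have $\bigcap_{n\in\omega}F_n\neq\emptyset$. A topological space $\langle X,\tau\rangle$ is Cantor completely metrizable if there is a Cantor complete metric $d$ on $X$ with $\tau=\tau(d)$. *)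

(* Defs.v *)
(* The result is a theorem of ZF without choice, whereas Rocq's types together
   with the usual classical axioms satisfy the axiom of choice (and a cuf set
   would then just be a countable set).  So the statement is made about an
   arbitrary model of first-order ZF: every notion below is a formula of set
   theory, its quantifiers ranging over the elements of the model.  By the
   completeness theorem, truth in all models is the same as provability in ZF. *)

Set Implicit Arguments.
Unset Strict Implicit.

Record structure := Structure {
  carrier :> Type;
  mem : carrier -> carrier -> Prop
}.

Declare Scope zf_scope.
Delimit Scope zf_scope with zf.
Local Open Scope zf_scope.

Notation "x ∈ y" := (mem x y) (at level 70, no associativity) : zf_scope.
Notation "x ∉ y" := (~ mem x y) (at level 70, no associativity) : zf_scope.

Definition subset (M : structure) (a b : M) : Prop :=
  forall x : M, x ∈ a -> x ∈ b.
Notation "a ⊆ b" := (subset a b) (at level 70, no associativity) : zf_scope.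

(* Variables are de Bruijn indices.  The two schemas must range over these
   formulas only: instances for all Rocq predicates would, with choice in the
   metatheory, force the axiom of choice in the model. *)
Inductive formula :=
| Mem (i j : nat)
| Eq (i j : nat)
| Not (f : formula)
| And (f g : formula)
| Or (f g : formula)
| Imp (f g : formula)
| All (f : formula)
| Ex (f : formula).

Definition scons (T : Type) (x : T) (e : nat -> T) : nat -> T :=
  fun n => match n with O => x | S m => e m end.

Fixpoint sat (M : structure) (e : nat -> M) (f : formula) : Prop :=
  match f with
  | Mem i j => e i ∈ e j
  | Eq i j => e i = e j
  | Not g => ~ sat e g
  | And g h => sat e g /\ sat e h
  | Or g h => sat e g \/ sat e h
  | Imp g h => sat e g -> sat e h
  | All g => forall x : M, sat (scons x e) g
  | Ex g => exists x : M, sat (scons x e) g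
  end.

Definition is_empty (M : structure) (a : M) : Prop := forall x : M, x ∉ a.

Definition nonempty (M : structure) (a : M) : Prop := exists x : M, x ∈ a.

Definition is_upair (M : structure) (x y a : M) : Prop :=
  forall z : M, z ∈ a <-> z = x \/ z = y.

Definition is_succ (M : structure) (x s : M) : Prop :=
  forall z : M, z ∈ s <-> z ∈ x \/ z = x.

Definition is_union (M : structure) (a u : M) : Prop :=
  forall x : M, x ∈ u <-> exists y : M, y ∈ a /\ x ∈ y.

Definition is_inter (M : structure) (a b c : M) : Prop :=
  forall x : M, x ∈ c <-> x ∈ a /\ x ∈ b.

Definition is_diff (M : structure) (a b c : M) : Prop :=
  forall x : M, x ∈ c <-> x ∈ a /\ x ∉ b.

Definition inductive_set (M : structure) (w : M) : Prop :=
  (exists z : M, is_empty z /\ z ∈ w) /\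
  (forall x : M, x ∈ w -> exists s : M, is_succ x s /\ s ∈ w).

Record ZF (M : structure) : Prop := {
  ZF_extensionality : forall a b : M,
    (forall x : M, x ∈ a <-> x ∈ b) -> a = b;
  ZF_foundation : forall a : M,
    nonempty a -> exists x : M, x ∈ a /\ forall y : M, y ∈ x -> y ∉ a;
  ZF_pairing : forall x y : M, exists a : M, is_upair x y a;
  ZF_union : forall a : M, exists u : M, is_union a u;
  ZF_power_set : forall a : M, exists p : M, forall x : M, x ∈ p <-> x ⊆ a;
  ZF_infinity : exists w : M, inductive_set w;
  ZF_separation : forall (f : formula) (e : nat -> M) (a : M),
    exists b : M, forall x : M, x ∈ b <-> x ∈ a /\ sat (scons x e) f;
  ZF_replacement : forall (f : formula) (e : nat -> M) (a : M),
    (forall x y y' : M, x ∈ a ->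
       sat (scons y (scons x e)) f -> sat (scons y' (scons x e)) f -> y = y') ->
    exists b : M, forall y : M,
      y ∈ b <-> exists x : M, x ∈ a /\ sat (scons y (scons x e)) f
}.

(** p = ⟨x, y⟩ (Kuratowski) *)
Definition is_opair (M : structure) (x y p : M) : Prop :=
  exists a b : M, is_upair x x a /\ is_upair x y b /\ is_upair a b p.

(** ⟨x, y⟩ ∈ f; when f is a function, f(x) = y *)
Definition app (M : structure) (f x y : M) : Prop :=
  exists p : M, is_opair x y p /\ p ∈ f.

Definition app2 (M : structure) (f x y z : M) : Prop :=
  exists q : M, is_opair x y q /\ app f q z.

Definition is_product (M : structure) (a b q : M) : Prop :=
  forall p : M, p ∈ q <-> exists x y : M, x ∈ a /\ y ∈ b /\ is_opair x y p.

Definition function_on (M : structure) (f a : M) : Prop :=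
  (forall p : M, p ∈ f -> exists x y : M, x ∈ a /\ is_opair x y p) /\
  (forall x : M, x ∈ a -> exists! y : M, app f x y).

Definition function (M : structure) (f a b : M) : Prop :=
  function_on f a /\ (forall x y : M, app f x y -> y ∈ b).

Definition function2 (M : structure) (f a b c : M) : Prop :=
  exists q : M, is_product a b q /\ function f q c.

Definition bijection (M : structure) (f a b : M) : Prop :=
  function f a b /\ (forall y : M, y ∈ b -> exists! x : M, app f x y).

Definition equipotent (M : structure) (a b : M) : Prop :=
  exists f : M, bijection f a b.

Definition is_omega (M : structure) (w : M) : Prop :=
  inductive_set w /\ forall v : M, inductive_set v -> w ⊆ v.

Definition finite (M : structure) (a : M) : Prop :=
  exists w n : M, is_omega w /\ n ∈ w /\ equipotent a n.

Definition countable (M : structure) (a : M) : Prop :=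
  exists w s : M, is_omega w /\ s ⊆ w /\ equipotent a s.

Definition cuf (M : structure) (a : M) : Prop :=
  exists c : M, countable c /\ (forall x : M, x ∈ c -> finite x) /\ is_union c a.

Record topology (M : structure) (X T : M) : Prop := {
  topology_sub : forall U : M, U ∈ T -> U ⊆ X;
  topology_full : X ∈ T;
  topology_inter : forall U V W : M, U ∈ T -> V ∈ T -> is_inter U V W -> W ∈ T;
  (* the case C = ∅ gives ∅ ∈ T *)
  topology_union : forall C U : M, C ⊆ T -> is_union C U -> U ∈ T
}.

Definition closed (M : structure) (X T F : M) : Prop :=
  F ⊆ X /\ exists U : M, is_diff X F U /\ U ∈ T.

Definition hausdorff (M : structure) (X T : M) : Prop :=
  forall x y : M, x ∈ X -> y ∈ X -> x <> y ->
  exists U V : M, U ∈ T /\ V ∈ T /\ x ∈ U /\ y ∈ V /\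
    forall z : M, ~ (z ∈ U /\ z ∈ V).

Definition covers (M : structure) (C K : M) : Prop :=
  forall x : M, x ∈ K -> exists U : M, U ∈ C /\ x ∈ U.

Definition compact (M : structure) (T K : M) : Prop :=
  forall C : M, C ⊆ T -> covers C K ->
  exists D : M, D ⊆ C /\ finite D /\ covers D K.

Definition neighbourhood (M : structure) (X T x N : M) : Prop :=
  N ⊆ X /\ exists U : M, U ∈ T /\ x ∈ U /\ U ⊆ N.

Definition locally_compact (M : structure) (X T : M) : Prop :=
  forall x : M, x ∈ X -> exists K : M, neighbourhood X T x K /\ compact T K.

Definition is_base (M : structure) (T B : M) : Prop :=
  B ⊆ T /\
  forall U : M, U ∈ T -> exists C : M, C ⊆ B /\ is_union C U.

Definition has_cuf_base (M : structure) (T : M) : Prop :=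
  exists B : M, is_base T B /\ cuf B.

(* With G empty this is P = X, the intersection being taken inside X. *)
Definition G_delta (M : structure) (X T P : M) : Prop :=
  exists G : M, G ⊆ T /\ countable G /\
    forall x : M, x ∈ P <-> x ∈ X /\ forall U : M, U ∈ G -> x ∈ U.

Definition is_subspace_topology (M : structure) (T P S : M) : Prop :=
  forall W : M, W ∈ S <-> exists U : M, U ∈ T /\ is_inter U P W.

Record ordered_structure (M : structure) := OrderedStructure {
  points : M;
  add : M;
  mul : M;
  le : M;
  zero : M;
  one : M
}.

Definition lt (M : structure) (R : ordered_structure M) (x y : M) : Prop :=
  app (le R) x y /\ x <> y.

Definition upper_bound (M : structure) (R : ordered_structure M) (A s : M) : Prop :=
  s ∈ points R /\ forall x : M, x ∈ A -> app (le R) x s.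

Definition is_sup (M : structure) (R : ordered_structure M) (A s : M) : Prop :=
  upper_bound R A s /\ forall t : M, upper_bound R A t -> app (le R) s t.

(* Dedekind completeness is required for the subsets that belong to M: this is
   "R is a complete ordered field" as a formula of set theory, which in ZF
   determines the field of real numbers up to a unique isomorphism. *)
Record complete_ordered_field (M : structure) (R : ordered_structure M) : Prop := {
  add_function : function2 (add R) (points R) (points R) (points R);
  mul_function : function2 (mul R) (points R) (points R) (points R);
  zero_point : zero R ∈ points R;
  one_point : one R ∈ points R;
  one_neq_zero : one R <> zero R;
  add_assoc : forall x y z u v s : M,
    app2 (add R) x y u -> app2 (add R) u z s -> app2 (add R) y z v ->
    app2 (add R) x v s;
  add_comm : forall x y s : M, app2 (add R) x y s -> app2 (add R) y x s;
  add_zero : forall x : M, x ∈ points R -> app2 (add R) x (zero R) x;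
  add_opp : forall x : M, x ∈ points R ->
    exists y : M, y ∈ points R /\ app2 (add R) x y (zero R);
  mul_assoc : forall x y z u v s : M,
    app2 (mul R) x y u -> app2 (mul R) u z s -> app2 (mul R) y z v ->
    app2 (mul R) x v s;
  mul_comm : forall x y s : M, app2 (mul R) x y s -> app2 (mul R) y x s;
  mul_one : forall x : M, x ∈ points R -> app2 (mul R) x (one R) x;
  mul_inv : forall x : M, x ∈ points R -> x <> zero R ->
    exists y : M, y ∈ points R /\ app2 (mul R) x y (one R);
  mul_add : forall x y z u s v w : M,
    app2 (add R) y z u -> app2 (mul R) x u s ->
    app2 (mul R) x y v -> app2 (mul R) x z w ->
    app2 (add R) v w s;
  le_antisym : forall x y : M, x ∈ points R -> y ∈ points R ->
    app (le R) x y -> app (le R) y x -> x = y;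
  le_trans : forall x y z : M,
    x ∈ points R -> y ∈ points R -> z ∈ points R ->
    app (le R) x y -> app (le R) y z -> app (le R) x z;
  le_total : forall x y : M, x ∈ points R -> y ∈ points R ->
    app (le R) x y \/ app (le R) y x;
  le_add : forall x y z u v : M,
    x ∈ points R -> y ∈ points R -> app (le R) x y ->
    app2 (add R) x z u -> app2 (add R) y z v -> app (le R) u v;
  le_mul : forall x y z : M,
    app (le R) (zero R) x -> app (le R) (zero R) y ->
    app2 (mul R) x y z -> app (le R) (zero R) z;
  sup_complete : forall A : M, A ⊆ points R -> nonempty A ->
    (exists s : M, upper_bound R A s) -> exists s : M, is_sup R A s
}.

Record metric (M : structure) (R : ordered_structure M) (X d : M) : Prop := {
  metric_function : function2 d X X (points R);
  metric_nonneg : forall x y r : M, app2 d x y r -> app (le R) (zero R) r;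
  metric_zero : forall x y r : M, app2 d x y r -> (r = zero R <-> x = y);
  metric_sym : forall x y r : M, app2 d x y r -> app2 d y x r;
  metric_triangle : forall x y z r s t u : M,
    app2 d x z r -> app2 d x y s -> app2 d y z t -> app2 (add R) s t u ->
    app (le R) r u
}.

Definition is_metric_topology (M : structure) (R : ordered_structure M)
    (X d T : M) : Prop :=
  forall U : M, U ∈ T <-> U ⊆ X /\ forall x : M, x ∈ U ->
    exists eps : M, eps ∈ points R /\ lt R (zero R) eps /\
      forall y r : M, y ∈ X -> app2 d x y r -> lt R r eps -> y ∈ U.

(* No s satisfies this when d is unbounded on A, i.e. when the diameter is +∞. *)
Definition is_diameter (M : structure) (R : ordered_structure M)
    (d A s : M) : Prop :=
  exists D : M,
    (forall r : M, r ∈ D <-> exists x y : M, x ∈ A /\ y ∈ A /\ app2 d x y r) /\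
    is_sup R D s.

(* Both the order on ω and the index n of F_n are taken in the model, so that
   m < n reads m ∈ n, and F is an element of the model. *)
Definition cantor_complete (M : structure) (R : ordered_structure M)
    (X d : M) : Prop :=
  forall T w F : M, is_metric_topology R X d T -> is_omega w ->
  function_on F w ->
  (forall n A : M, app F n A -> closed X T A /\ nonempty A) ->
  (forall m n A B : M, app F m A -> app F n B -> m ∈ n -> B ⊆ A) ->
  (forall eps : M, eps ∈ points R -> lt R (zero R) eps ->
     exists N : M, N ∈ w /\ forall n A : M, app F n A -> N = n \/ N ∈ n ->
       exists s : M, is_diameter R d A s /\ lt R s eps) ->
  exists x : M, forall n A : M, app F n A -> x ∈ A.

Definition cantor_completely_metrizable (M : structure) (R : ordered_structure M)
    (X T : M) : Prop :=
  exists d : M, metric R X d /\ cantor_complete R X d /\ is_metric_topology R X d T.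

(* Main.v *)
From Stdlib Require Import Classical ClassicalEpsilon PeanoNat.
Require Import Defs.

(** The argument takes place inside the model, and every separation and every
    induction over ω is applied to a class that is shown to be definable.

    No choice is needed because every object is canonical.  Write the base as
    an increasing union of finite sets β(n), and call an open set U way below V
    when some compact set lies between them.  The union of those members of
    β(n) that are way below V is way below V (a finite union of compact sets is
    compact), and for growing n these unions exhaust V ([inner]).  So the first
    of them that U is way below interpolates between U and V ([interpolant]).

    A family of pairs ⟨U, V⟩ with U way below V defines an entourage: x and y
    are near when, for each pair, a point in U forces the other one into V.
    Inserting two interpolants into each pair gives a family whose entourage is
    a cube root of the given one ([near_refine]).  If the family is locally
    finite on P, its entourage is a neighbourhood of the diagonal of P
    ([near_open]).  Let P be the intersection of the open sets g(k).  The
    families are built by recursion: stage k + 1 refines stage k and adds the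
    pairs of [base_pairs k], namely finitely many pairs that make the entourages
    small at each point, and pairs through which g(k) is exhausted by sets way
    below it.

    A sequence of entourages with this cube root property gives a metric
    ([metrization]): a chain of steps costs the sum of the costs h(k) of its
    steps, where h is a sequence obtained by repeated halving, and the distance
    is the infimum of the costs.  Cutting a chain at half of its cost shows by
    induction on its length that a chain cheaper than h(k) stays in the k-th
    entourage ([cost_split], [cost_entourage]).

    For completeness, a set that is small for the entourage of stage k + 1 and
    meets P is way below g(k).  So, given a descending sequence of nonempty closed
    sets F(n) with diameters tending to 0, for each k some F(n) lies in a
    compact subset of g(k).  By compactness the F(n) accumulate at a point p;
    it belongs to every g(k), hence to P, hence to every F(n). *)

Set Implicit Arguments.
Unset Strict Implicit.

Local Open Scope zf_scope.

(* The set operations are total functions that depend on the axioms; type class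
   resolution supplies the latter. *)
Existing Class ZF.

(** * Definable predicates and terms *)

(** Renaming of the free variables. *)
Fixpoint rename (r : nat -> nat) (f : formula) : formula :=
  let up := fun n => match n with O => O | S m => S (r m) end in
  match f with
  | Mem i j => Mem (r i) (r j)
  | Eq i j => Eq (r i) (r j)
  | Not g => Not (rename r g)
  | And g h => And (rename r g) (rename r h)
  | Or g h => Or (rename r g) (rename r h)
  | Imp g h => Imp (rename r g) (rename r h)
  | All g => All (rename up g)
  | Ex g => Ex (rename up g)
  end.

Section Definability.

Context {M : structure}.

Definition env := nat -> M.

Definition tl (e : env) : env := fun n => e (S n).

Lemma sat_ext (f : formula) :
  forall e e' : env, (forall n, e n = e' n) -> sat e f <-> sat e' f.
Proof.
  induction f; intros e e' H; simpl;
    try (rewrite !H; tauto);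
    try (specialize (IHf _ _ H); tauto);
    try (specialize (IHf1 _ _ H); specialize (IHf2 _ _ H); tauto).
  - split; intros A x; apply (IHf (scons x e) (scons x e')); auto;
      intros [|n]; simpl; auto.
  - split; intros [x A]; exists x; apply (IHf (scons x e) (scons x e')); auto;
      intros [|n]; simpl; auto.
Qed.

Lemma sat_rename (f : formula) :
  forall (r : nat -> nat) (e : env),
    sat e (rename r f) <-> sat (fun n => e (r n)) f.
Proof.
  induction f; intros r e; simpl; try tauto;
    try (rewrite IHf; tauto); try (rewrite IHf1, IHf2; tauto).
  - split; intros A x; [specialize (A x); rewrite IHf in A | rewrite IHf];
      (eapply sat_ext; [|apply A]); intros [|n]; reflexivity.
  - split; intros [x A]; exists x; [rewrite IHf in A | rewrite IHf];
      (eapply sat_ext; [|apply A]); intros [|n]; reflexivity.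
Qed.

(** Each variable stands, according to [s], either for an entry of the
    environment or for a parameter, a fixed element of the model. *)
Definition value (s : nat -> nat + M) (e : env) : env :=
  fun n => match s n with inl i => e i | inr c => c end.

(** A predicate on environments is definable when it is given by a formula with
    parameters from the model. *)
Definition fdef (P : env -> Prop) : Prop :=
  exists (f : formula) (s : nat -> nat + M), forall e, P e <-> sat (value s e) f.

(** An element depending on an environment is definable when its graph is;
    entry 0 of the environment is the value. *)
Definition tdef (t : env -> M) : Prop := fdef (fun e => e 0 = t (tl e)).

Lemma fdef_ext (P Q : env -> Prop) :
  (forall e, P e <-> Q e) -> fdef P -> fdef Q.
Proof.
  intros H (f & s & A). exists f, s. intro e. rewrite <- H. apply A.
Qed.

(* Two formulas get disjoint sets of free variables: the even ones and the odd
   ones. *)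
Lemma merge_values (s s' : nat -> nat + M) :
  exists s2 : nat -> nat + M, forall e n,
    value s2 e (2 * n) = value s e n /\ value s2 e (2 * n + 1) = value s' e n.
Proof.
  exists (fun n => if Nat.even n then s (Nat.div2 n) else s' (Nat.div2 n)).
  intros e n; unfold value. split.
  - rewrite Nat.even_even, Nat.div2_double. reflexivity.
  - rewrite Nat.even_odd, Nat.add_1_r, Nat.div2_succ_double. reflexivity.
Qed.

Lemma fdef_binary (c : formula -> formula -> formula) (o : Prop -> Prop -> Prop)
    (P Q : env -> Prop) :
  (forall (e : env) f g, sat e (c f g) <-> o (sat e f) (sat e g)) ->
  (forall A A' B B' : Prop, (A <-> A') -> (B <-> B') -> (o A B <-> o A' B')) ->
  fdef P -> fdef Q -> fdef (fun e => o (P e) (Q e)).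
Proof.
  intros Hc Ho (f & s & A) (g & s' & B).
  destruct (merge_values s s') as [s2 H2].
  exists (c (rename (fun n => 2 * n) f) (rename (fun n => 2 * n + 1) g)), s2.
  intro e. rewrite Hc. apply Ho.
  - rewrite A, sat_rename. apply sat_ext. intro n. symmetry. apply H2.
  - rewrite B, sat_rename. apply sat_ext. intro n. symmetry. apply H2.
Qed.

Lemma fdef_and (P Q : env -> Prop) :
  fdef P -> fdef Q -> fdef (fun e => P e /\ Q e).
Proof. apply fdef_binary with (c := And); simpl; tauto. Qed.

Lemma fdef_or (P Q : env -> Prop) :
  fdef P -> fdef Q -> fdef (fun e => P e \/ Q e).
Proof. apply fdef_binary with (c := Or); simpl; tauto. Qed.

Lemma fdef_imp (P Q : env -> Prop) :
  fdef P -> fdef Q -> fdef (fun e => P e -> Q e).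
Proof.
  apply fdef_binary with (c := Imp) (o := fun A B : Prop => A -> B); simpl; tauto.
Qed.

Lemma fdef_not (P : env -> Prop) : fdef P -> fdef (fun e => ~ P e).
Proof.
  intros (f & s & A). exists (Not f), s. intro e. simpl. rewrite A. tauto.
Qed.

Lemma fdef_iff (P Q : env -> Prop) :
  fdef P -> fdef Q -> fdef (fun e => P e <-> Q e).
Proof. intros; apply fdef_and; apply fdef_imp; assumption. Qed.

(** A formula whose entry 0 is bound by a quantifier can be written with the
    bound variable in front of the other entries and the parameters. *)
Lemma bind_value (s : nat -> nat + M) :
  exists (r : nat -> nat) (s' : nat -> nat + M), forall x e n,
    scons x (value s' e) (r n) = value s (scons x e) n.
Proof.
  exists (fun n => match s n with inl O => O | _ => S n end).
  exists (fun n => match s n with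
                   | inl O => inl O | inl (S i) => inl i | inr c => inr c end).
  intros x e n. unfold value. destruct (s n) as [[|i]|c] eqn:E; simpl;
    try rewrite E; reflexivity.
Qed.

Lemma fdef_ex (Q : env -> M -> Prop) :
  fdef (fun e => Q (tl e) (e 0)) -> fdef (fun e => exists x, Q e x).
Proof.
  intros (f & s & A). destruct (bind_value s) as (r & s' & H).
  exists (Ex (rename r f)), s'. intro e. simpl.
  split; intros [x B]; exists x.
  - rewrite sat_rename. specialize (A (scons x e)); simpl in A.
    eapply sat_ext; [|apply A, B]. intro n; apply H.
  - rewrite sat_rename in B. apply (A (scons x e)).
    eapply sat_ext; [|apply B]. intro n; symmetry; apply H.
Qed.

Lemma fdef_all (Q : env -> M -> Prop) :
  fdef (fun e => Q (tl e) (e 0)) -> fdef (fun e => forall x, Q e x).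
Proof.
  intros (f & s & A). destruct (bind_value s) as (r & s' & H).
  exists (All (rename r f)), s'. intro e. simpl.
  split; intros B x; specialize (B x).
  - rewrite sat_rename. specialize (A (scons x e)); simpl in A.
    eapply sat_ext; [|apply A, B]. intro n; apply H.
  - rewrite sat_rename in B. apply (A (scons x e)).
    eapply sat_ext; [|apply B]. intro n; symmetry; apply H.
Qed.

(** A predicate that does not depend on the environment is definable whatever
    it says, since it is equivalent to a true or to a false formula. *)
Lemma fdef_const (P : Prop) : fdef (fun _ => P).
Proof.
  destruct (classic P) as [p|p].
  - exists (Imp (Mem 0 0) (Mem 0 0)), (fun n => inl n). intro e; simpl; tauto.
  - exists (Not (Imp (Mem 0 0) (Mem 0 0))), (fun n => inl n).
    intro e; simpl; tauto.
Qed.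

Lemma tdef_var (i : nat) : tdef (fun e => e i).
Proof. exists (Eq 0 (S i)), (fun n => inl n). intro e; simpl; reflexivity. Qed.

Lemma tdef_const (c : M) : tdef (fun _ => c).
Proof.
  exists (Eq 0 1), (fun n => match n with O => inl O | _ => inr c end).
  intro e; simpl; reflexivity.
Qed.

Lemma fdef_mem01 : fdef (fun e => e 0 ∈ e 1).
Proof. exists (Mem 0 1), (fun n => inl n). intro e; simpl; reflexivity. Qed.

Lemma fdef_eq01 : fdef (fun e => e 0 = e 1).
Proof. exists (Eq 0 1), (fun n => inl n). intro e; simpl; reflexivity. Qed.

Lemma fdef_reindex (r : nat -> nat) (P : env -> Prop) :
  fdef P -> fdef (fun e => P (fun n => e (r n))).
Proof.
  intros (f & s & A).
  exists f, (fun n => match s n with inl i => inl (r i) | inr c => inr c end).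
  intro e. rewrite A. apply sat_ext. intro n. unfold value.
  destruct (s n); reflexivity.
Qed.

(** Substitution of a definable term for variable 0. *)
Lemma fdef_subst (P : env -> M -> Prop) (t : env -> M) :
  fdef (fun e => P (tl e) (e 0)) -> tdef t -> fdef (fun e => P e (t e)).
Proof.
  intros HP Ht.
  apply (@fdef_ext (fun e => exists x, x = t e /\ P e x)).
  - intro e; split.
    + intros (x & -> & H); exact H.
    + intro H; exists (t e); auto.
  - apply fdef_ex, fdef_and; assumption.
Qed.

Lemma tdef_weaken (t : env -> M) : tdef t -> tdef (fun e => t (tl e)).
Proof.
  apply (fdef_reindex (fun n => match n with O => O | S m => S (S m) end)).
Qed.

Lemma fdef_lift1 (P : M -> Prop) (t : env -> M) :
  fdef (fun e => P (e 0)) -> tdef t -> fdef (fun e => P (t e)).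
Proof. apply (@fdef_subst (fun _ x => P x)). Qed.

Lemma fdef_lift2 (P : M -> M -> Prop) (t u : env -> M) :
  fdef (fun e => P (e 0) (e 1)) -> tdef t -> tdef u ->
  fdef (fun e => P (t e) (u e)).
Proof.
  intros HP Ht Hu. apply (@fdef_subst (fun e x => P (t e) x)); [|exact Hu].
  apply (@fdef_subst (fun e x => P x (e 0))); [|exact (tdef_weaken Ht)].
  exact HP.
Qed.

Lemma fdef_lift3 (P : M -> M -> M -> Prop) (t u v : env -> M) :
  fdef (fun e => P (e 0) (e 1) (e 2)) -> tdef t -> tdef u -> tdef v ->
  fdef (fun e => P (t e) (u e) (v e)).
Proof.
  intros HP Ht Hu Hv. apply (@fdef_subst (fun e x => P (t e) (u e) x)); [|exact Hv].
  apply (@fdef_subst (fun e x => P (t (tl e)) x (e 0))); [|exact (tdef_weaken Hu)].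
  apply (@fdef_subst (fun e x => P x (e 0) (e 1)));
    [|exact (tdef_weaken (tdef_weaken Ht))].
  exact HP.
Qed.

Lemma fdef_mem (t u : env -> M) :
  tdef t -> tdef u -> fdef (fun e => t e ∈ u e).
Proof. apply (fdef_lift2 (P := @mem M)), fdef_mem01. Qed.

Lemma fdef_eq (t u : env -> M) :
  tdef t -> tdef u -> fdef (fun e => t e = u e).
Proof. apply (fdef_lift2 (P := @eq M)), fdef_eq01. Qed.

Lemma tdef_lift1 (F : M -> M) (t : env -> M) :
  tdef (fun e => F (e 0)) -> tdef t -> tdef (fun e => F (t e)).
Proof.
  intros HF Ht. apply (@fdef_lift2 (fun y x => y = F x)).
  - apply (fdef_reindex (fun n => n)). exact HF.
  - apply tdef_var.
  - apply (tdef_weaken Ht).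
Qed.

Lemma tdef_lift2 (F : M -> M -> M) (t u : env -> M) :
  tdef (fun e => F (e 0) (e 1)) -> tdef t -> tdef u ->
  tdef (fun e => F (t e) (u e)).
Proof.
  intros HF Ht Hu. apply (@fdef_lift3 (fun y x x' => y = F x x')).
  - exact HF.
  - apply tdef_var.
  - apply (tdef_weaken Ht).
  - apply (tdef_weaken Hu).
Qed.

(** One-place predicates that may be used in separation. *)
Definition def1 (P : M -> Prop) : Prop := fdef (fun e => P (e 0)).

Lemma def1_formula (P : M -> Prop) :
  def1 P -> forall e0 : env,
  exists (f : formula) (e : env), forall x, P x <-> sat (scons x e) f.
Proof.
  intros (f & s & A) e0. destruct (bind_value s) as (r & s' & H).
  exists (rename r f), (value s' e0). intro x. rewrite sat_rename.
  specialize (A (scons x e0)); simpl in A. rewrite A.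
  apply sat_ext. intro n; symmetry; apply H.
Qed.

End Definability.

(** * Basic set operations *)

Section Description.

Context {M : structure} {hM : ZF M}.

Lemma model_inhabited : inhabited M.
Proof. destruct (ZF_infinity hM) as [w _]. exact (inhabits w). Qed.

Lemma set_ext (a b : M) : (forall x, x ∈ a <-> x ∈ b) -> a = b.
Proof. apply ZF_extensionality; assumption. Qed.

Lemma separation (P : M -> Prop) (a : M) :
  def1 P -> exists b : M, forall x, x ∈ b <-> x ∈ a /\ P x.
Proof.
  intro H. destruct model_inhabited as [m].
  destruct (def1_formula H (fun _ => m)) as (f & e & A).
  destruct (ZF_separation hM f e a) as [b B].
  exists b. intro x. rewrite B, A. reflexivity.
Qed.

Lemma empty_exists : exists b : M, is_empty b.
Proof.
  destruct model_inhabited as [m].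
  destruct (@separation (fun _ => False) m (fdef_const _)) as [b B].
  exists b. intros x Hx. apply B in Hx. tauto.
Qed.

(** The element described by [P], the empty set when [P] describes no unique
    element; with this default the operator preserves definability. *)
Definition the (P : M -> Prop) : M :=
  epsilon model_inhabited
    (fun y => unique P y \/ (~ (exists y, unique P y) /\ is_empty y)).

Lemma the_graph (P : M -> Prop) (y : M) :
  y = the P <-> unique P y \/ (~ (exists y, unique P y) /\ is_empty y).
Proof.
  assert (S : unique P (the P) \/ (~ (exists y, unique P y) /\ is_empty (the P))).
  { unfold the. apply epsilon_spec. destruct (classic (exists y, unique P y)) as [[z Hz]|N].
    - exists z; auto.
    - destruct empty_exists as [z Hz]. exists z; auto. }
  split.
  - intros ->; exact S.
  - intros [[A U]|[N E]]; destruct S as [[B V]|[N' E']].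
    + apply U, B.
    + exfalso; apply N'; exists y; split; assumption.
    + exfalso; apply N; exists (the P); split; assumption.
    + apply set_ext. intro x; split; intro H; [destruct (E x H)|destruct (E' x H)].
Qed.

Lemma the_eq (P : M -> Prop) (y : M) :
  P y -> (forall z, P z -> y = z) -> the P = y.
Proof. intros A B. symmetry. apply the_graph. left; split; assumption. Qed.

Lemma the_spec (P : M -> Prop) : (exists! y, P y) -> P (the P).
Proof. intros [y [A B]]. rewrite (the_eq A B). exact A. Qed.

Lemma tdef_the (P : env -> M -> Prop) :
  fdef (fun e => P (tl e) (e 0)) -> tdef (fun e => the (P e)).
Proof.
  intro H.
  assert (U : fdef (fun e => unique (P (tl e)) (e 0))).
  { apply fdef_and; [exact H|]. apply fdef_all, fdef_imp.
    - apply (fdef_reindex (fun n => match n with O => O | S m => S (S m) end) H).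
    - apply fdef_eq; apply tdef_var. }
  unfold tdef.
  eapply fdef_ext; [intro e; symmetry; apply the_graph|].
  apply fdef_or; [exact U|]. apply fdef_and.
  - apply fdef_not, fdef_ex.
    apply (fdef_reindex (fun n => match n with O => O | S m => S (S m) end) U).
  - apply fdef_all, fdef_not, fdef_mem; apply tdef_var.
Qed.

(** The set of all x with [P x]; meaningful only when this class is a set. *)
Definition setof (P : M -> Prop) : M := the (fun b => forall x, x ∈ b <-> P x).

Lemma in_setof (P : M -> Prop) :
  (exists b, forall x, x ∈ b <-> P x) -> forall x, x ∈ setof P <-> P x.
Proof.
  intros [b B]. apply (the_spec (P := fun b => forall x, x ∈ b <-> P x)).
  exists b; split; [exact B|]. intros c C. apply set_ext. intro x.
  rewrite B, C. reflexivity.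
Qed.

Lemma tdef_setof (P : env -> M -> Prop) :
  fdef (fun e => P (tl e) (e 0)) -> tdef (fun e => setof (P e)).
Proof.
  intro H. apply tdef_the. apply fdef_all, fdef_iff.
  - apply fdef_mem; apply tdef_var.
  - apply (fdef_reindex (fun n => match n with O => O | S m => S (S m) end) H).
Qed.

Definition sep (a : M) (P : M -> Prop) : M := setof (fun x => x ∈ a /\ P x).

Lemma in_sep (a : M) (P : M -> Prop) (x : M) :
  def1 P -> x ∈ sep a P <-> x ∈ a /\ P x.
Proof. intro H. apply in_setof. apply separation, H. Qed.

Lemma tdef_sep (t : env -> M) (P : env -> M -> Prop) :
  tdef t -> fdef (fun e => P (tl e) (e 0)) -> tdef (fun e => sep (t e) (P e)).
Proof.
  intros Ht HP. apply tdef_setof, fdef_and; [|exact HP].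
  apply fdef_mem; [apply tdef_var|apply (tdef_weaken Ht)].
Qed.

End Description.

(** Definability is proved along the shape of the predicate or term; the tactic
    [definable_extra] is redefined whenever further operations have been shown
    to be definable. *)
Ltac definable_extra := fail.

Ltac definable_step :=
  cbv beta delta [tl def1];
  lazymatch goal with
  | |- fdef (fun _ => ?P) => apply fdef_const
  | |- tdef (fun _ => ?c) => apply tdef_const
  | |- tdef (fun e => e _) => apply tdef_var
  | |- fdef (fun e => _ ∈ _) => apply fdef_mem
  | |- fdef (fun e => _ = _) => apply fdef_eq
  | |- fdef (fun e => _ /\ _) => apply fdef_and
  | |- fdef (fun e => _ \/ _) => apply fdef_or
  | |- fdef (fun e => ~ _) => apply fdef_not
  | |- fdef (fun e => _ <-> _) => apply fdef_iff
  | |- fdef (fun e => _ ⊆ _) => unfold subset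
  | |- fdef (fun e => exists x, _) => apply fdef_ex
  | |- fdef (fun e => forall x : carrier _, _) => apply fdef_all
  | |- fdef (fun e => _ -> _) => apply fdef_imp
  | |- tdef (fun e => the _) => apply tdef_the
  | |- tdef (fun e => setof _) => apply tdef_setof
  | |- tdef (fun e => sep _ _) => apply tdef_sep
  | _ => definable_extra
  end.

Ltac definability := solve [repeat definable_step].

Section SetOperations.

Context {M : structure} {hM : ZF M}.

Definition empty : M := setof (fun _ => False).
Definition upair (a b : M) : M := setof (fun x => x = a \/ x = b).
Definition sing (a : M) : M := setof (fun x => x = a).
Definition bigcup (a : M) : M := setof (fun x => exists y, y ∈ a /\ x ∈ y).
Definition cup (a b : M) : M := setof (fun x => x ∈ a \/ x ∈ b).
Definition cap (a b : M) : M := sep a (fun x => x ∈ b).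
Definition diff (a b : M) : M := sep a (fun x => ~ x ∈ b).
Definition pow (a : M) : M := setof (fun x => x ⊆ a).
Definition succ (a : M) : M := setof (fun x => x ∈ a \/ x = a).
(** The Kuratowski pair. *)
Definition opair (a b : M) : M := upair (upair a a) (upair a b).

Lemma in_empty (x : M) : ~ x ∈ empty.
Proof.
  unfold empty. rewrite in_setof; [tauto|].
  destruct empty_exists as [b B]. exists b. intro y; split; [apply B|tauto].
Qed.

Lemma in_upair (a b x : M) : x ∈ upair a b <-> x = a \/ x = b.
Proof. unfold upair. rewrite in_setof; [tauto|apply (ZF_pairing hM)]. Qed.

Lemma in_sing (a x : M) : x ∈ sing a <-> x = a.
Proof.
  unfold sing. rewrite in_setof; [tauto|]. destruct (ZF_pairing hM a a) as [b B].
  exists b. intro y. rewrite (B y). tauto.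
Qed.

Lemma in_bigcup (a x : M) : x ∈ bigcup a <-> exists y, y ∈ a /\ x ∈ y.
Proof. unfold bigcup. rewrite in_setof; [tauto|apply (ZF_union hM)]. Qed.

Lemma in_cup (a b x : M) : x ∈ cup a b <-> x ∈ a \/ x ∈ b.
Proof.
  unfold cup. rewrite in_setof; [tauto|]. exists (bigcup (upair a b)).
  intro y. rewrite in_bigcup.
  split.
  - intros (z & Hz & H). apply in_upair in Hz. destruct Hz; subst; auto.
  - intros [H|H]; [exists a|exists b]; rewrite in_upair; auto.
Qed.

Lemma in_cap (a b x : M) : x ∈ cap a b <-> x ∈ a /\ x ∈ b.
Proof. unfold cap. rewrite in_sep; [tauto|definability]. Qed.

Lemma in_diff (a b x : M) : x ∈ diff a b <-> x ∈ a /\ ~ x ∈ b.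
Proof. unfold diff. rewrite in_sep; [tauto|definability]. Qed.

Lemma in_pow (a x : M) : x ∈ pow a <-> x ⊆ a.
Proof. unfold pow. rewrite in_setof; [tauto|apply (ZF_power_set hM)]. Qed.

Lemma in_succ (a x : M) : x ∈ succ a <-> x ∈ a \/ x = a.
Proof.
  unfold succ. rewrite in_setof; [tauto|]. exists (cup a (sing a)). intro y.
  rewrite in_cup, in_sing. reflexivity.
Qed.

Lemma is_empty_eq (a : M) : is_empty a -> a = empty.
Proof.
  intro H. apply set_ext. intro x. split; intro A;
    [destruct (H x A)|destruct (in_empty A)].
Qed.

Lemma upair_inj (a b c d : M) :
  upair a b = upair c d -> (a = c /\ b = d) \/ (a = d /\ b = c).
Proof.
  intro E.
  assert (Ha : a = c \/ a = d) by (rewrite <- in_upair, <- E, in_upair; auto).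
  assert (Hb : b = c \/ b = d) by (rewrite <- in_upair, <- E, in_upair; auto).
  assert (Hc : c = a \/ c = b) by (rewrite <- in_upair, E, in_upair; auto).
  assert (Hd : d = a \/ d = b) by (rewrite <- in_upair, E, in_upair; auto).
  destruct Ha, Hb, Hc, Hd; subst; auto.
Qed.

Lemma opair_inj (a b c d : M) : opair a b = opair c d -> a = c /\ b = d.
Proof.
  intro E. destruct (upair_inj E) as [[E1 E2]|[E1 E2]];
  destruct (upair_inj E1) as [[? ?]|[? ?]];
  destruct (upair_inj E2) as [[? ?]|[? ?]]; subst; auto.
Qed.

Lemma is_upair_eq (x y a : M) : is_upair x y a <-> a = upair x y.
Proof.
  split.
  - intro H. apply set_ext. intro z. rewrite (H z), in_upair. reflexivity.
  - intros -> z. apply in_upair.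
Qed.

Lemma is_opair_eq (x y p : M) : is_opair x y p <-> p = opair x y.
Proof.
  unfold is_opair. split.
  - intros (a & b & A & B & C). apply is_upair_eq in A, B, C. subst. reflexivity.
  - intros ->. exists (upair x x), (upair x y). rewrite !is_upair_eq. auto.
Qed.

Lemma app_opair (f x y : M) : app f x y <-> opair x y ∈ f.
Proof.
  unfold app. split.
  - intros (p & A & B). apply is_opair_eq in A. subst; assumption.
  - intro H. exists (opair x y). rewrite is_opair_eq. auto.
Qed.

Lemma app2_opair (f x y z : M) : app2 f x y z <-> opair (opair x y) z ∈ f.
Proof.
  unfold app2. split.
  - intros (p & A & B). apply is_opair_eq in A. subst. apply app_opair, B.
  - intro H. exists (opair x y). rewrite is_opair_eq, app_opair. auto.
Qed.

Lemma is_union_eq (a u : M) : is_union a u <-> u = bigcup a.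
Proof.
  split.
  - intro H. apply set_ext. intro z. rewrite (H z), in_bigcup. reflexivity.
  - intros -> z. apply in_bigcup.
Qed.

Lemma is_inter_eq (a b c : M) : is_inter a b c <-> c = cap a b.
Proof.
  split.
  - intro H. apply set_ext. intro z. rewrite (H z), in_cap. reflexivity.
  - intros -> z. apply in_cap.
Qed.

Lemma is_diff_eq (a b c : M) : is_diff a b c <-> c = diff a b.
Proof.
  split.
  - intro H. apply set_ext. intro z. rewrite (H z), in_diff. reflexivity.
  - intros -> z. apply in_diff.
Qed.

Lemma is_succ_eq (a c : M) : is_succ a c <-> c = succ a.
Proof.
  split.
  - intro H. apply set_ext. intro z. rewrite (H z), in_succ. reflexivity.
  - intros -> z. apply in_succ.
Qed.

Lemma tdef_upair (t u : env -> M) :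
  tdef t -> tdef u -> tdef (fun e => upair (t e) (u e)).
Proof. apply tdef_lift2. unfold upair. definability. Qed.

Lemma tdef_sing (t : env -> M) : tdef t -> tdef (fun e => sing (t e)).
Proof. apply tdef_lift1. unfold sing. definability. Qed.

Lemma tdef_bigcup (t : env -> M) : tdef t -> tdef (fun e => bigcup (t e)).
Proof. apply tdef_lift1. unfold bigcup. definability. Qed.

Lemma tdef_cup (t u : env -> M) :
  tdef t -> tdef u -> tdef (fun e => cup (t e) (u e)).
Proof. apply tdef_lift2. unfold cup. definability. Qed.

Lemma tdef_cap (t u : env -> M) :
  tdef t -> tdef u -> tdef (fun e => cap (t e) (u e)).
Proof. apply tdef_lift2. unfold cap. definability. Qed.

Lemma tdef_pow (t : env -> M) : tdef t -> tdef (fun e => pow (t e)).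
Proof. apply tdef_lift1. unfold pow. definability. Qed.

Lemma tdef_succ (t : env -> M) : tdef t -> tdef (fun e => succ (t e)).
Proof. apply tdef_lift1. unfold succ. definability. Qed.

Lemma tdef_opair (t u : env -> M) :
  tdef t -> tdef u -> tdef (fun e => opair (t e) (u e)).
Proof.
  intros Ht Hu. apply tdef_upair; apply tdef_upair; assumption.
Qed.

End SetOperations.

Ltac definable_sets :=
  lazymatch goal with
  | |- tdef (fun e => sing _) => apply tdef_sing
  | |- tdef (fun e => bigcup _) => apply tdef_bigcup
  | |- tdef (fun e => cup _ _) => apply tdef_cup
  | |- tdef (fun e => cap _ _) => apply tdef_cap
  | |- tdef (fun e => pow _) => apply tdef_pow
  | |- tdef (fun e => succ _) => apply tdef_succ
  | |- tdef (fun e => opair _ _) => apply tdef_opair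
  end.

Ltac definable_extra ::= definable_sets.

Section Products.

Context {M : structure} {hM : ZF M}.

Definition prod (a b : M) : M :=
  sep (pow (pow (cup a b)))
    (fun p => exists x y, x ∈ a /\ y ∈ b /\ p = opair x y).

Lemma in_prod (a b p : M) :
  p ∈ prod a b <-> exists x y, x ∈ a /\ y ∈ b /\ p = opair x y.
Proof.
  unfold prod. rewrite in_sep by definability. split; [tauto|].
  intro H; split; [|exact H]. destruct H as (x & y & Hx & Hy & ->).
  apply in_pow. intros z Hz. apply in_upair in Hz. apply in_pow. intros t Ht.
  apply in_cup. destruct Hz; subst z; apply in_upair in Ht;
    destruct Ht; subst t; auto.
Qed.

Lemma opair_prod (a b x y : M) : opair x y ∈ prod a b <-> x ∈ a /\ y ∈ b.
Proof.
  rewrite in_prod. split.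
  - intros (x' & y' & Hx & Hy & E). apply opair_inj in E. destruct E; subst; auto.
  - intros [Hx Hy]. exists x, y. auto.
Qed.

Lemma is_product_eq (a b q : M) : is_product a b q <-> q = prod a b.
Proof.
  assert (A : forall p, (exists x y, x ∈ a /\ y ∈ b /\ is_opair x y p) <->
                         p ∈ prod a b).
  { intro p. rewrite in_prod. split; intros (x & y & Hx & Hy & E); exists x, y;
      rewrite is_opair_eq in *; auto. }
  split.
  - intro H. apply set_ext. intro p. rewrite (H p). apply A.
  - intros -> p. symmetry. apply A.
Qed.

(** The coordinates of an ordered pair. *)
Definition p1 (p : M) : M := the (fun x => exists y, p = opair x y).
Definition p2 (p : M) : M := the (fun y => exists x, p = opair x y).

Lemma p1_opair (x y : M) : p1 (opair x y) = x.
Proof.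
  apply the_eq; [exists y; reflexivity|].
  intros z [t E]. apply opair_inj in E. apply E.
Qed.

Lemma p2_opair (x y : M) : p2 (opair x y) = y.
Proof.
  apply the_eq; [exists x; reflexivity|].
  intros z [t E]. apply opair_inj in E. apply E.
Qed.

Lemma tdef_p1 (t : env -> M) : tdef t -> tdef (fun e => p1 (t e)).
Proof. apply tdef_lift1. unfold p1. definability. Qed.

Lemma tdef_p2 (t : env -> M) : tdef t -> tdef (fun e => p2 (t e)).
Proof. apply tdef_lift1. unfold p2. definability. Qed.

End Products.

Ltac definable_products :=
  lazymatch goal with
  | |- tdef (fun e => p1 _) => apply tdef_p1
  | |- tdef (fun e => p2 _) => apply tdef_p2
  | _ => definable_sets
  end.

Ltac definable_extra ::= definable_products.

(** * Natural numbers and recursion *)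

Section Omega.

Context {M : structure} {hM : ZF M}.

(** The intersection of all inductive sets. *)
Definition omega : M := setof (fun n => forall v, inductive_set v -> n ∈ v).

Lemma inductive_set_iff (v : M) :
  inductive_set v <-> empty ∈ v /\ forall x, x ∈ v -> succ x ∈ v.
Proof.
  unfold inductive_set. split.
  - intros [(z & Hz & Hv) H]. split.
    + rewrite <- (is_empty_eq Hz). exact Hv.
    + intros x Hx. destruct (H x Hx) as (s & Es & Hs).
      apply is_succ_eq in Es. subst; exact Hs.
  - intros [H0 H]. split.
    + exists empty. split; [intro x; apply in_empty|exact H0].
    + intros x Hx. exists (succ x). rewrite is_succ_eq. auto.
Qed.

Lemma in_omega (n : M) : n ∈ omega <-> forall v, inductive_set v -> n ∈ v.
Proof.
  unfold omega. rewrite in_setof; [tauto|]. destruct (ZF_infinity hM) as [w Hw].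
  exists (sep w (fun n => forall v, inductive_set v -> n ∈ v)).
  intro x. rewrite in_sep.
  - split; [tauto|]. intro H; split; [apply H, Hw|exact H].
  - apply fdef_ext with
      (P := fun e => forall v, empty ∈ v /\ (forall x, x ∈ v -> succ x ∈ v) -> e 0 ∈ v).
    + intro e; split; intros H v Hv; apply H; apply inductive_set_iff; exact Hv.
    + definability.
Qed.

Lemma omega_0 : empty ∈ omega.
Proof. apply in_omega. intros v Hv. apply inductive_set_iff in Hv. apply Hv. Qed.

Lemma omega_S (n : M) : n ∈ omega -> succ n ∈ omega.
Proof.
  rewrite !in_omega. intros H v Hv. specialize (H v Hv).
  apply inductive_set_iff in Hv. apply Hv, H.
Qed.

Lemma omega_ind (P : M -> Prop) :
  def1 P -> P empty -> (forall n, n ∈ omega -> P n -> P (succ n)) ->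
  forall n, n ∈ omega -> P n.
Proof.
  intros HP H0 HS n Hn.
  assert (A : n ∈ sep omega P).
  { apply in_omega; [exact Hn|]. apply inductive_set_iff. split.
    - apply in_sep; auto using omega_0.
    - intros x Hx. apply in_sep in Hx; [|exact HP]. apply in_sep; [exact HP|].
      destruct Hx; auto using omega_S. }
  apply in_sep in A; tauto.
Qed.

Lemma is_omega_eq (w : M) : is_omega w <-> w = omega.
Proof.
  assert (I : inductive_set omega)
    by (apply inductive_set_iff; auto using omega_0, omega_S).
  split.
  - intros [A B]. apply set_ext. intro n; split; intro H.
    + apply (B _ I _ H).
    + apply in_omega; assumption.
  - intros ->. split; [exact I|]. intros v Hv n Hn. apply in_omega; assumption.
Qed.

Lemma succ_neq_empty (n : M) : succ n <> empty.
Proof. intro E. apply (@in_empty M hM n). rewrite <- E. apply in_succ; auto. Qed.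

Lemma mem_asym (x y : M) : x ∈ y -> ~ y ∈ x.
Proof.
  intros H K. destruct (ZF_foundation hM (a := upair x y)) as (z & Hz & A).
  - exists x. apply in_upair; auto.
  - apply in_upair in Hz. destruct Hz; subst z.
    + apply (A y K), in_upair; auto.
    + apply (A x H), in_upair; auto.
Qed.

Lemma succ_inj (m n : M) : succ m = succ n -> m = n.
Proof.
  intro E.
  assert (A : m ∈ n \/ m = n) by (rewrite <- in_succ, <- E; apply in_succ; auto).
  assert (B : n ∈ m \/ n = m) by (rewrite <- in_succ, E; apply in_succ; auto).
  destruct A as [A|A]; [|exact A]. destruct B as [B|B]; [|auto].
  destruct (mem_asym A B).
Qed.

Lemma omega_elem (n : M) : n ∈ omega -> forall m, m ∈ n -> m ∈ omega.
Proof.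
  intros Hn. apply (omega_ind (P := fun n => forall m, m ∈ n -> m ∈ omega));
    [definability| |  |exact Hn].
  - intros m H; destruct (in_empty H).
  - intros k Hk IH m H. apply in_succ in H. destruct H; subst; auto.
Qed.

Lemma omega_trans (n : M) :
  n ∈ omega -> forall m k, m ∈ n -> k ∈ m -> k ∈ n.
Proof.
  intros Hn. apply (omega_ind (P := fun n => forall m k, m ∈ n -> k ∈ m -> k ∈ n));
    [definability| |  |exact Hn].
  - intros m k H; destruct (in_empty H).
  - intros j Hj IH m k H K. apply in_succ in H. apply in_succ. left.
    destruct H; subst; eauto.
Qed.

Lemma empty_in_succ (n : M) : n ∈ omega -> empty ∈ succ n.
Proof.
  intros Hn. apply (omega_ind (P := fun n => empty ∈ succ n));
    [definability| |  |exact Hn].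
  - apply in_succ; auto.
  - intros k Hk IH. apply in_succ. auto.
Qed.

Lemma succ_mono (n : M) : n ∈ omega -> forall m, m ∈ n -> succ m ∈ succ n.
Proof.
  intros Hn. apply (omega_ind (P := fun n => forall m, m ∈ n -> succ m ∈ succ n));
    [definability| |  |exact Hn].
  - intros m H; destruct (in_empty H).
  - intros k Hk IH m H. apply in_succ in H. apply in_succ.
    destruct H as [H|H]; subst; auto.
Qed.

Lemma omega_trichotomy (m n : M) :
  m ∈ omega -> n ∈ omega -> m ∈ n \/ m = n \/ n ∈ m.
Proof.
  intros Hm Hn. revert m Hm.
  apply (omega_ind (P := fun n => forall m, m ∈ omega -> m ∈ n \/ m = n \/ n ∈ m));
    [definability| |  |exact Hn].
  - intros m Hm. apply (@empty_in_succ m) in Hm. apply in_succ in Hm.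
    destruct Hm; auto.
  - intros k Hk IH m Hm. destruct (IH m Hm) as [A|[A|A]].
    + left. apply in_succ; auto.
    + left. apply in_succ; auto.
    + apply (succ_mono Hm) in A. apply in_succ in A. destruct A; auto.
Qed.

Lemma least_number (P : M -> Prop) :
  def1 P -> (exists n, n ∈ omega /\ P n) ->
  exists n, n ∈ omega /\ P n /\ forall m, m ∈ n -> ~ P m.
Proof.
  intros HP (n & Hn & Pn).
  destruct (ZF_foundation hM (a := sep omega P)) as (x & Hx & A).
  - exists n. apply in_sep; auto.
  - apply in_sep in Hx; [|exact HP]. destruct Hx as [Hx Px].
    exists x. split; [exact Hx|]. split; [exact Px|]. intros m Hm Pm.
    apply (A m Hm). apply in_sep; [exact HP|]. split; [|exact Pm].
    apply (omega_elem Hx Hm).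
Qed.

(** A set of pairs ⟨k, y⟩ in which each one either starts the recursion or
    results from a pair one step earlier.  An attempt need not be a function;
    [attempt_unique] shows that all attempts agree. *)
Definition attempt (a : M) (F : M -> M -> M) (f : M) : Prop :=
  forall k y, opair k y ∈ f ->
    (k = empty /\ y = a) \/
    exists i w, k = succ i /\ y = F i w /\ opair i w ∈ f.

(** The function on ω with value [a] at 0 and [F n y] at n + 1, where [y] is
    the value at n. *)
Definition rec (a : M) (F : M -> M -> M) (k : M) : M :=
  the (fun y => exists f, attempt a F f /\ opair k y ∈ f).

Lemma fdef_attempt (a : M) (F : M -> M -> M) (t : env -> M) :
  tdef (fun e => F (e 0) (e 1)) -> tdef t -> fdef (fun e => attempt a F (t e)).
Proof.
  intros HF. apply fdef_lift1. unfold attempt.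
  apply fdef_all, fdef_all, fdef_imp; [definability|].
  apply fdef_or; [definability|]. apply fdef_ex, fdef_ex.
  apply fdef_and; [definability|]. apply fdef_and; [|definability].
  apply fdef_eq; [definability|].
  apply (tdef_lift2 HF); apply tdef_var.
Qed.

Lemma attempt_unique (a : M) (F : M -> M -> M) (k : M) :
  tdef (fun e => F (e 0) (e 1)) -> k ∈ omega ->
  forall f g y z, attempt a F f -> attempt a F g ->
    opair k y ∈ f -> opair k z ∈ g -> y = z.
Proof.
  intros HF Hk.
  cut (forall f, attempt a F f -> forall y, opair k y ∈ f ->
       forall g, attempt a F g -> forall z, opair k z ∈ g -> y = z).
  { intros H f g y z A B C D. exact (H f A y C g B z D). }
  revert k Hk.
  apply (omega_ind (P := fun k => forall f, attempt a F f ->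
    forall y, opair k y ∈ f -> forall g, attempt a F g ->
    forall z, opair k z ∈ g -> y = z)).
  - apply fdef_all, fdef_imp; [apply (fdef_attempt _ HF), tdef_var|].
    apply fdef_all, fdef_imp; [definability|].
    apply fdef_all, fdef_imp; [apply (fdef_attempt _ HF), tdef_var|definability].
  - intros f A y Hy g B z Hz.
    destruct (A _ _ Hy) as [[_ ->]|(i & w & E & _)];
      [|destruct (succ_neq_empty (eq_sym E))].
    destruct (B _ _ Hz) as [[_ ->]|(i & w & E & _)];
      [|destruct (succ_neq_empty (eq_sym E))].
    reflexivity.
  - intros n Hn IH f A y Hy g B z Hz.
    destruct (A _ _ Hy) as [[E _]|(i & w & E & -> & Hw)];
      [destruct (succ_neq_empty E)|].
    destruct (B _ _ Hz) as [[E' _]|(i' & w' & E' & -> & Hw')];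
      [destruct (succ_neq_empty E')|].
    apply succ_inj in E, E'. subst i i'.
    rewrite (IH f A w Hw g B w' Hw'). reflexivity.
Qed.

Lemma attempt_exists (a : M) (F : M -> M -> M) (k : M) :
  tdef (fun e => F (e 0) (e 1)) -> k ∈ omega ->
  exists y f, attempt a F f /\ opair k y ∈ f.
Proof.
  intros HF Hk. revert k Hk.
  apply (omega_ind (P := fun k => exists y f, attempt a F f /\ opair k y ∈ f)).
  - apply fdef_ex, fdef_ex, fdef_and; [apply (fdef_attempt _ HF), tdef_var|definability].
  - exists a, (sing (opair empty a)). split; [|apply in_sing; auto].
    intros j y H. apply in_sing, opair_inj in H. auto.
  - intros n Hn (y & f & A & H).
    exists (F n y), (cup f (sing (opair (succ n) (F n y)))).
    split; [|apply in_cup; right; apply in_sing; auto].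
    intros j z Hz. apply in_cup in Hz. destruct Hz as [Hz|Hz].
    + destruct (A _ _ Hz) as [B|(i & w & B & C & D)]; [auto|].
      right. exists i, w. rewrite in_cup. auto.
    + apply in_sing, opair_inj in Hz. destruct Hz as [-> ->].
      right. exists n, y. rewrite in_cup. auto.
Qed.

Section Rec.

Context (a : M) (F : M -> M -> M) (HF : tdef (fun e => F (e 0) (e 1))).

Lemma rec_eq (f k y : M) :
  k ∈ omega -> attempt a F f -> opair k y ∈ f -> rec a F k = y.
Proof.
  intros Hk A H. apply the_eq; [exists f; auto|].
  intros z (g & B & K). apply (attempt_unique HF Hk A B H K).
Qed.

Lemma rec_0 : rec a F empty = a.
Proof.
  apply rec_eq with (f := sing (opair empty a));
    [apply omega_0| |apply in_sing; auto].
  intros j y H. apply in_sing, opair_inj in H. auto.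
Qed.

Lemma rec_S (n : M) : n ∈ omega -> rec a F (succ n) = F n (rec a F n).
Proof.
  intro Hn. destruct (attempt_exists a HF (omega_S Hn)) as (y & f & A & H).
  rewrite (rec_eq (omega_S Hn) A H).
  destruct (A _ _ H) as [[E _]|(i & w & E & -> & K)]; [destruct (succ_neq_empty E)|].
  apply succ_inj in E; subst i. rewrite (rec_eq Hn A K). reflexivity.
Qed.

Lemma tdef_rec (t : env -> M) : tdef t -> tdef (fun e => rec a F (t e)).
Proof.
  apply tdef_lift1. unfold rec. apply tdef_the, fdef_ex, fdef_and; [|definability].
  apply (fdef_attempt _ HF), tdef_var.
Qed.

End Rec.

End Omega.
(** * Finite sets *)

Section Finiteness.

Context {M : structure} {hM : ZF M}.

(** Kuratowski finiteness: [A] is reached from the empty set by adding elements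
    of [A] one at a time. *)
Definition kfinite (A : M) : Prop :=
  forall F : M, empty ∈ F ->
    (forall Z a, Z ∈ F -> a ∈ A -> cup Z (sing a) ∈ F) -> A ∈ F.

Lemma fdef_kfinite (t : env -> M) : tdef t -> fdef (fun e => kfinite (t e)).
Proof. apply fdef_lift1. unfold kfinite. definability. Qed.

Lemma kfinite_ind (P : M -> Prop) (A : M) :
  def1 P -> kfinite A -> P empty ->
  (forall Z a, Z ⊆ A -> a ∈ A -> P Z -> P (cup Z (sing a))) -> P A.
Proof.
  intros HP HA H0 HS.
  assert (K : A ∈ sep (pow A) P).
  { apply HA.
    - rewrite in_sep by exact HP. split; [|exact H0].
      apply in_pow. intros x Hx; destruct (in_empty Hx).
    - intros Z a HZ Ha. rewrite in_sep in * by exact HP.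
      rewrite in_pow in *. destruct HZ as [HZ PZ]. split; [|auto].
      intros x Hx. apply in_cup in Hx. destruct Hx as [Hx|Hx]; [auto|].
      apply in_sing in Hx; subst; exact Ha. }
  rewrite in_sep in K by exact HP. apply K.
Qed.

Lemma cup_empty (a : M) : cup a empty = a.
Proof.
  apply set_ext. intro x. rewrite in_cup. pose proof (@in_empty _ _ x). tauto.
Qed.

Lemma cup_assoc (a b c : M) : cup a (cup b c) = cup (cup a b) c.
Proof. apply set_ext. intro x. rewrite !in_cup. tauto. Qed.

Lemma kfinite_empty : kfinite empty.
Proof. intros F H _. exact H. Qed.

Lemma kfinite_add (A a : M) : kfinite A -> kfinite (cup A (sing a)).
Proof.
  intros HA F H0 HS. apply HS.
  - apply HA; [exact H0|]. intros Z b HZ Hb. apply HS; [exact HZ|].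
    apply in_cup; auto.
  - apply in_cup; right. apply in_sing; reflexivity.
Qed.

Lemma kfinite_subsingleton (A : M) :
  (forall x y, x ∈ A -> y ∈ A -> x = y) -> kfinite A.
Proof.
  intro H. destruct (classic (nonempty A)) as [[x Hx]|N].
  - replace A with (cup empty (sing x)); [apply kfinite_add, kfinite_empty|].
    apply set_ext. intro y. rewrite in_cup, in_sing. split.
    + intros [Hy|Hy]; [destruct (in_empty Hy)|subst; exact Hx].
    + intro Hy. right. auto.
  - replace A with (@empty M hM); [apply kfinite_empty|].
    symmetry. apply is_empty_eq. intros x Hx. apply N. exists x; exact Hx.
Qed.

Lemma kfinite_sing (a : M) : kfinite (sing a).
Proof.
  apply kfinite_subsingleton. intros x y Hx Hy. apply in_sing in Hx, Hy.
  congruence.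
Qed.

Lemma kfinite_subset (A B : M) : kfinite A -> B ⊆ A -> kfinite B.
Proof.
  intros HA HB. replace B with (cap A B).
  - apply (kfinite_ind (P := fun Z => kfinite (cap Z B))) with (A := A);
      [|exact HA| |].
    + apply fdef_kfinite. definability.
    + replace (cap empty B) with (@empty M hM); [apply kfinite_empty|].
      symmetry. apply is_empty_eq. intros x Hx. apply in_cap in Hx.
      apply (@in_empty _ _ x), Hx.
    + intros Z a _ _ IH. destruct (classic (a ∈ B)) as [Ha|Ha].
      * replace (cap (cup Z (sing a)) B) with (cup (cap Z B) (sing a));
          [apply kfinite_add, IH|].
        apply set_ext. intro x. rewrite !in_cap, !in_cup, in_cap, in_sing.
        split; [|tauto]. intros [H|H]; [tauto|subst; tauto].
      * replace (cap (cup Z (sing a)) B) with (cap Z B); [exact IH|].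
        apply set_ext. intro x. rewrite !in_cap, !in_cup, in_sing.
        split; [tauto|]. intros [[H|H] K]; [tauto|subst; tauto].
  - apply set_ext. intro x. rewrite in_cap. split; [tauto|auto].
Qed.

Lemma kfinite_cup (A B : M) : kfinite A -> kfinite B -> kfinite (cup A B).
Proof.
  intros HA HB.
  apply (kfinite_ind (P := fun Z => kfinite (cup A Z))) with (A := B);
    [|exact HB| |].
  - apply fdef_kfinite. definability.
  - rewrite cup_empty. exact HA.
  - intros Z a _ _ IH. rewrite cup_assoc. apply kfinite_add, IH.
Qed.

(** A set covered by a definable family of finite sets with a finite index set
    is finite. *)
Lemma kfinite_union (A S : M) (t : M -> M) :
  tdef (fun e => t (e 0)) -> kfinite A -> (forall a, a ∈ A -> kfinite (t a)) ->
  (forall x, x ∈ S -> exists a, a ∈ A /\ x ∈ t a) -> kfinite S.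
Proof.
  intros Ht HA HtA HS.
  set (R := fun Z => sep S (fun x => exists a, a ∈ Z /\ x ∈ t a)).
  assert (D : forall Z, def1 (fun x => exists a, a ∈ Z /\ x ∈ t a)).
  { intro Z. apply fdef_ex, fdef_and; [definability|].
    apply fdef_mem; [definability|]. apply (tdef_lift1 Ht), tdef_var. }
  assert (RS : forall Z x, x ∈ R Z <-> x ∈ S /\ exists a, a ∈ Z /\ x ∈ t a).
  { intros Z x. unfold R. rewrite in_sep by apply D. reflexivity. }
  apply kfinite_subset with (A := R A);
    [|intros x Hx; apply RS; split; [exact Hx|apply HS, Hx]].
  apply (kfinite_ind (P := fun Z => kfinite (R Z))) with (A := A); [|exact HA| |].
  - apply fdef_kfinite. unfold R. apply tdef_sep; [definability|].
    apply fdef_ex, fdef_and; [definability|].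
    apply fdef_mem; [definability|]. apply (tdef_lift1 Ht), tdef_var.
  - apply kfinite_subset with (A := empty); [apply kfinite_empty|].
    intros x Hx. apply RS in Hx. destruct Hx as (_ & a & Ha & _).
    destruct (in_empty Ha).
  - intros Z a _ Ha IH.
    apply kfinite_subset with (A := cup (R Z) (t a)).
    + apply kfinite_cup; [exact IH|apply HtA, Ha].
    + intros x Hx. apply RS in Hx. destruct Hx as (HxS & b & Hb & Hx).
      apply in_cup in Hb. apply in_cup. destruct Hb as [Hb|Hb].
      * left. apply RS. split; [exact HxS|]. exists b; auto.
      * right. apply in_sing in Hb; subst; exact Hx.
Qed.

Lemma kfinite_number (n : M) : n ∈ omega -> kfinite n.
Proof.
  revert n. apply omega_ind; [apply fdef_kfinite; definability|apply kfinite_empty|].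
  intros n _ IH. apply kfinite_subset with (A := cup n (sing n)).
  - apply kfinite_add, IH.
  - intros x Hx. apply in_succ in Hx. rewrite in_cup, in_sing. exact Hx.
Qed.

Lemma finite_kfinite (a : M) : finite a -> kfinite a.
Proof.
  intros (w & n & Hw & Hn & f & [[Hf1 Hf2] Hf3] & Hb).
  apply is_omega_eq in Hw; subst w.
  apply (kfinite_union (A := n) (t := fun y => sep a (fun x => opair x y ∈ f))).
  - definability.
  - apply kfinite_number, Hn.
  - intros y Hy. apply kfinite_subsingleton. intros x x' Hx Hx'.
    rewrite in_sep in Hx, Hx' by definability.
    destruct (Hb y Hy) as (z & _ & U).
    transitivity z; [symmetry|]; apply U, app_opair; tauto.
  - intros x Hx. destruct (Hf2 x Hx) as (y & Hy & _).
    exists y. split; [apply (Hf3 x y Hy)|].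
    rewrite in_sep by definability. split; [exact Hx|]. apply app_opair, Hy.
Qed.

(** A countable set is numbered: some relation [e] attaches numbers to its
    elements, different numbers to different elements. *)
Lemma countable_numbering (c : M) :
  countable c -> exists e : M,
    (forall z, z ∈ c -> exists k, k ∈ omega /\ opair z k ∈ e) /\
    (forall z z' k, z ∈ c -> z' ∈ c -> opair z k ∈ e -> opair z' k ∈ e -> z = z').
Proof.
  intros (w & s & Hw & Hs & e & [[He1 He2] He3] & Hb).
  apply is_omega_eq in Hw; subst w.
  exists e. split.
  - intros z Hz. destruct (He2 z Hz) as (k & Hk & _). exists k.
    split; [apply Hs, (He3 z k Hk)|apply app_opair, Hk].
  - intros z z' k Hz Hz' H H'. apply app_opair in H, H'.
    destruct (Hb k (He3 z k H)) as (y & _ & U).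
    transitivity y; [symmetry|]; apply U; assumption.
Qed.

End Finiteness.

(** * Compact sets and interpolation of open sets *)

Section Topology.

Context {M : structure} {hM : ZF M}.

Lemma open_empty (X T : M) : topology X T -> empty ∈ T.
Proof.
  intro hT. apply (topology_union hT) with (C := empty).
  - intros x Hx; destruct (in_empty Hx).
  - apply is_union_eq. symmetry. apply is_empty_eq. intros x Hx.
    apply in_bigcup in Hx. destruct Hx as (y & Hy & _). apply (in_empty Hy).
Qed.

Lemma open_bigcup (X T C : M) : topology X T -> C ⊆ T -> bigcup C ∈ T.
Proof.
  intros hT H. apply (topology_union hT H). apply is_union_eq. reflexivity.
Qed.

Lemma open_cup (X T U V : M) : topology X T -> U ∈ T -> V ∈ T -> cup U V ∈ T.
Proof.
  intros hT HU HV. replace (cup U V) with (bigcup (upair U V)).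
  - apply (open_bigcup hT). intros W HW. apply in_upair in HW.
    destruct HW; subst; assumption.
  - apply set_ext. intro x. rewrite in_bigcup, in_cup. split.
    + intros (W & HW & Hx). apply in_upair in HW. destruct HW; subst; auto.
    + intros [H|H]; [exists U|exists V]; rewrite in_upair; auto.
Qed.

Lemma open_cap (X T U V : M) : topology X T -> U ∈ T -> V ∈ T -> cap U V ∈ T.
Proof.
  intros hT HU HV. apply (topology_inter hT HU HV). apply is_inter_eq. reflexivity.
Qed.

(** Compactness in terms of directed covers: an ideal of open sets that covers
    [K] has a single member that contains [K]. *)
Definition ideal_compact (T K : M) : Prop :=
  forall I : M, I ⊆ T -> empty ∈ I ->
    (forall U V, U ∈ I -> V ∈ I -> cup U V ∈ I) -> covers I K ->
    exists V, V ∈ I /\ K ⊆ V.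

Lemma compact_ideal_compact (T K : M) : compact T K -> ideal_compact T K.
Proof.
  intros HK I HI I0 IU IC. destruct (HK I HI IC) as (D & HD & FD & CD).
  assert (A : bigcup D ∈ I).
  { apply (kfinite_ind (P := fun Z => bigcup Z ∈ I)) with (A := D).
    - definability.
    - apply finite_kfinite, FD.
    - replace (bigcup empty) with (@empty M hM); [exact I0|].
      symmetry. apply is_empty_eq. intros x Hx.
      apply in_bigcup in Hx. destruct Hx as (y & Hy & _). apply (in_empty Hy).
    - intros Z a _ Ha IH. replace (bigcup (cup Z (sing a))) with (cup (bigcup Z) a).
      + apply IU; [exact IH|apply HD, Ha].
      + apply set_ext. intro x. rewrite in_cup, !in_bigcup. split.
        * intros [(y & Hy & Hx)|Hx]; [exists y|exists a];
            rewrite in_cup, in_sing; auto.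
        * intros (y & Hy & Hx). apply in_cup in Hy.
          destruct Hy as [Hy|Hy]; [left; exists y; auto|].
          apply in_sing in Hy; subst; auto. }
  exists (bigcup D). split; [exact A|]. intros x Hx. destruct (CD x Hx) as (U & HU & HxU).
  apply in_bigcup. exists U; auto.
Qed.

Lemma fdef_ideal_compact (t u : env -> M) :
  tdef t -> tdef u -> fdef (fun e => ideal_compact (t e) (u e)).
Proof. apply fdef_lift2. unfold ideal_compact, covers. definability. Qed.

Lemma ideal_compact_empty (T : M) : ideal_compact T empty.
Proof.
  intros I _ I0 _ _. exists empty. split; [exact I0|]. intros x Hx; exact Hx.
Qed.

Lemma ideal_compact_cup (T K L : M) :
  ideal_compact T K -> ideal_compact T L -> ideal_compact T (cup K L).
Proof.
  intros HK HL I HI I0 IU IC.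
  destruct (HK I HI I0 IU) as (V & HV & KV);
    [intros x Hx; apply IC, in_cup; auto|].
  destruct (HL I HI I0 IU) as (W & HW & LW);
    [intros x Hx; apply IC, in_cup; auto|].
  exists (cup V W). split; [apply IU; assumption|].
  intros x Hx. apply in_cup in Hx. apply in_cup. destruct Hx; auto.
Qed.

Lemma ideal_compact_diff (X T K O : M) :
  topology X T -> ideal_compact T K -> O ∈ T -> ideal_compact T (diff K O).
Proof.
  intros hT HK HO I HI I0 IU IC.
  set (J := sep T (fun V => exists W, W ∈ I /\ V ⊆ cup W O)).
  assert (HJ : forall V, V ∈ J <-> V ∈ T /\ exists W, W ∈ I /\ V ⊆ cup W O).
  { intro V. unfold J. rewrite in_sep by definability. reflexivity. }
  destruct (HK J) as (V & HV & KV).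
  - intros V HV. apply HJ in HV. tauto.
  - apply HJ. split; [apply (open_empty hT)|]. exists empty.
    split; [exact I0|]. intros x Hx; destruct (in_empty Hx).
  - intros V V' HV HV'. apply HJ in HV, HV'.
    destruct HV as (HV & W & HW & A), HV' as (HV' & W' & HW' & A').
    apply HJ. split; [apply (open_cup hT); assumption|]. exists (cup W W').
    split; [apply IU; assumption|]. intros x Hx.
    rewrite !in_cup in *. destruct Hx as [Hx|Hx];
      [apply A in Hx|apply A' in Hx]; apply in_cup in Hx; tauto.
  - intros x Hx. destruct (classic (x ∈ O)) as [Hxo|Hxo].
    + exists O. split; [|exact Hxo]. apply HJ. split; [exact HO|].
      exists empty. split; [exact I0|]. intros y Hy. apply in_cup; auto.
    + destruct (IC x) as (U & HU & HxU); [apply in_diff; auto|].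
      exists U. split; [|exact HxU]. apply HJ. split; [apply HI, HU|].
      exists U. split; [exact HU|]. intros y Hy. apply in_cup; auto.
  - apply HJ in HV. destruct HV as (_ & W & HW & A).
    exists W. split; [exact HW|]. intros x Hx. apply in_diff in Hx.
    destruct Hx as [Hx Hxo]. apply KV, A, in_cup in Hx. tauto.
Qed.

(** A compact set and a point outside it have disjoint neighbourhoods. *)
Lemma separate_compact (X T K x : M) :
  topology X T -> hausdorff X T -> ideal_compact T K -> K ⊆ X ->
  x ∈ X -> ~ x ∈ K ->
  exists O W, O ∈ T /\ W ∈ T /\ x ∈ O /\ K ⊆ W /\ forall z, ~ (z ∈ O /\ z ∈ W).
Proof.
  intros hT hH HK KX Hx HxK.
  set (J := sep T (fun W => exists O, O ∈ T /\ x ∈ O /\ forall z, ~ (z ∈ O /\ z ∈ W))).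
  assert (HJ : forall W, W ∈ J <->
    W ∈ T /\ exists O, O ∈ T /\ x ∈ O /\ forall z, ~ (z ∈ O /\ z ∈ W)).
  { intro V. unfold J. rewrite in_sep by definability. reflexivity. }
  destruct (HK J) as (W & HW & KW).
  - intros W HW. apply HJ in HW. tauto.
  - apply HJ. split; [apply (open_empty hT)|]. exists X.
    split; [apply (topology_full hT)|]. split; [exact Hx|].
    intros z [_ Hz]. apply (in_empty Hz).
  - intros V V' HV HV'. apply HJ in HV, HV'.
    destruct HV as (HV & O & HO & xO & A), HV' as (HV' & O' & HO' & xO' & A').
    apply HJ. split; [apply (open_cup hT); assumption|]. exists (cap O O').
    split; [apply (open_cap hT); assumption|].
    split; [apply in_cap; auto|]. intros z [Hz Hz'].
    apply in_cap in Hz. apply in_cup in Hz'. destruct Hz' as [Hz'|Hz'].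
    + apply (A z); tauto.
    + apply (A' z); tauto.
  - intros y Hy.
    destruct (hH x y Hx (KX y Hy)) as (O & W & HO & HW & xO & yW & A).
    + intros ->. apply HxK, Hy.
    + exists W. split; [|exact yW]. apply HJ. split; [exact HW|]. exists O; auto.
  - apply HJ in HW. destruct HW as (HW & O & HO & xO & A).
    exists O, W. auto.
Qed.

(** Some compact set lies between [U] and [V]. *)
Definition way_below (T U V : M) : Prop :=
  exists K, ideal_compact T K /\ U ⊆ K /\ K ⊆ V.

Lemma fdef_way_below (t u v : env -> M) :
  tdef t -> tdef u -> tdef v -> fdef (fun e => way_below (t e) (u e) (v e)).
Proof.
  apply fdef_lift3. unfold way_below. apply fdef_ex, fdef_and; [|definability].
  apply fdef_ideal_compact; definability.
Qed.

Lemma way_below_sub (T U V : M) : way_below T U V -> U ⊆ V.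
Proof. intros (K & _ & A & B) x Hx. auto. Qed.

Lemma way_below_mono (T U U' V V' : M) :
  U' ⊆ U -> V ⊆ V' -> way_below T U V -> way_below T U' V'.
Proof.
  intros HU HV (K & HK & A & B). exists K. split; [exact HK|].
  split; intros x Hx; auto.
Qed.

Lemma way_below_empty (T V : M) : way_below T empty V.
Proof.
  exists empty. split; [apply ideal_compact_empty|].
  split; intros x Hx; [exact Hx|destruct (in_empty Hx)].
Qed.

Lemma way_below_cup (T U U' V : M) :
  way_below T U V -> way_below T U' V -> way_below T (cup U U') V.
Proof.
  intros (K & HK & A & B) (L & HL & A' & B'). exists (cup K L).
  split; [apply ideal_compact_cup; assumption|].
  split; intros x Hx; rewrite in_cup in *; destruct Hx; auto.
Qed.

(** A locally compact Hausdorff space is regular, in the strong form that the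
    small neighbourhoods are basic and way below the given open set. *)
Lemma regular_base (X T B V x : M) :
  topology X T -> hausdorff X T -> locally_compact X T -> is_base T B ->
  V ∈ T -> x ∈ V -> exists b, b ∈ B /\ x ∈ b /\ way_below T b V.
Proof.
  intros hT hH hL [_ hB] HV Hx.
  assert (HxX : x ∈ X) by (apply (topology_sub hT HV), Hx).
  destruct (hL x HxX) as (N & (NX & U0 & HU0 & xU0 & UN) & CN).
  apply compact_ideal_compact in CN.
  destruct (@separate_compact X T (diff N V) x) as (O & W & HO & HW & xO & KW & dis);
    auto.
  { apply (ideal_compact_diff hT); assumption. }
  { intros y Hy. apply in_diff in Hy. apply NX; tauto. }
  { rewrite in_diff. tauto. }
  destruct (hB (cap O U0)) as (C & HC & EC); [apply (open_cap hT); assumption|].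
  apply is_union_eq in EC.
  assert (A : x ∈ bigcup C) by (rewrite <- EC; apply in_cap; auto).
  apply in_bigcup in A. destruct A as (b & Hb & xb).
  exists b. split; [apply HC, Hb|]. split; [exact xb|].
  assert (S : forall y, y ∈ b -> y ∈ O /\ y ∈ U0).
  { intros y Hy. apply in_cap. rewrite EC. apply in_bigcup. exists b; auto. }
  exists (diff N W). split; [apply (ideal_compact_diff hT); assumption|]. split.
  - intros y Hy. destruct (S y Hy) as [yO yU]. apply in_diff.
    split; [apply UN, yU|]. intro yW. apply (dis y); auto.
  - intros y Hy. apply in_diff in Hy. destruct Hy as [yN yW].
    apply NNPP. intro yV. apply yW, KW, in_diff. auto.
Qed.

(** A cuf set is the union of an increasing definable sequence of finite sets. *)
Lemma cuf_filtration (B : M) :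
  cuf B -> exists beta : M -> M,
    tdef (fun e => beta (e 0)) /\
    (forall n, n ∈ omega -> kfinite (beta n)) /\
    (forall n, beta n ⊆ B) /\
    (forall m n, n ∈ omega -> m ∈ n -> beta m ⊆ beta n) /\
    (forall b, b ∈ B -> exists n, n ∈ omega /\ b ∈ beta n).
Proof.
  intros (c & Hc & Hfin & Hun). apply is_union_eq in Hun.
  destruct (countable_numbering Hc) as (e & He & Hinj).
  set (beta := fun n => sep B (fun b => exists z k,
    z ∈ c /\ k ∈ succ n /\ opair z k ∈ e /\ b ∈ z)).
  assert (Hb : forall n b, b ∈ beta n <-> b ∈ B /\ exists z k,
    z ∈ c /\ k ∈ succ n /\ opair z k ∈ e /\ b ∈ z).
  { intros n b. unfold beta. rewrite in_sep by definability. reflexivity. }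
  exists beta. split; [unfold beta; definability|]. split; [|split; [|split]].
  - intros n Hn.
    apply (kfinite_union (A := succ n)
      (t := fun k => sep B (fun b => exists z, z ∈ c /\ opair z k ∈ e /\ b ∈ z))).
    + definability.
    + apply kfinite_number, omega_S, Hn.
    + intros k _.
      destruct (classic (exists z, z ∈ c /\ opair z k ∈ e)) as [(z & Hz & Hk)|N].
      * apply kfinite_subset with (A := z); [apply finite_kfinite, Hfin, Hz|].
        intros b H. rewrite in_sep in H by definability.
        destruct H as (_ & z' & Hz' & Hk' & H).
        rewrite (Hinj z z' k); assumption.
      * apply kfinite_subset with (A := empty); [apply kfinite_empty|].
        intros b H. rewrite in_sep in H by definability.
        destruct H as (_ & z' & Hz' & Hk' & H). destruct N. exists z'; auto.
    + intros b H. apply Hb in H. destruct H as (HB & z & k & Hz & Hk & Hzk & H).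
      exists k. split; [exact Hk|]. rewrite in_sep by definability.
      split; [exact HB|]. exists z; auto.
  - intros n b H. apply Hb in H. tauto.
  - intros m n Hn Hm b H. apply Hb in H. destruct H as (HB & z & k & Hz & Hk & H).
    apply Hb. split; [exact HB|]. exists z, k. split; [exact Hz|]. split; [|exact H].
    apply in_succ. left. apply in_succ in Hk. destruct Hk as [Hk|Hk].
    + apply (omega_trans Hn Hm Hk).
    + subst; exact Hm.
  - intros b H. pose proof H as H'. rewrite Hun in H'.
    apply in_bigcup in H'. destruct H' as (z & Hz & Hbz).
    destruct (He z Hz) as (k & Hk & Hzk). exists k. split; [exact Hk|].
    apply Hb. split; [exact H|]. exists z, k. rewrite in_succ. auto.
Qed.

(** A G_δ set is the intersection of a definable sequence of open sets. *)
Lemma G_delta_sequence (X T P : M) :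
  topology X T -> G_delta X T P -> exists g : M -> M,
    tdef (fun e => g (e 0)) /\ (forall n, g n ∈ T) /\
    (forall x, x ∈ P <-> forall n, n ∈ omega -> x ∈ g n).
Proof.
  intros hT (G & GT & Gc & HP).
  destruct (countable_numbering Gc) as (e & He & Hinj).
  set (g := fun k => sep X (fun x => forall U, U ∈ G -> opair U k ∈ e -> x ∈ U)).
  assert (Hg : forall k x, x ∈ g k <->
    x ∈ X /\ forall U, U ∈ G -> opair U k ∈ e -> x ∈ U).
  { intros k x. unfold g. rewrite in_sep by definability. reflexivity. }
  exists g. split; [unfold g; definability|]. split.
  - intro k.
    destruct (classic (exists U, U ∈ G /\ opair U k ∈ e)) as [(U & HU & Hk)|N].
    + replace (g k) with U; [apply GT, HU|]. apply set_ext. intro x. rewrite Hg.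
      split.
      * intro Hx. split; [apply (topology_sub hT (GT U HU)), Hx|].
        intros U' HU' Hk'. rewrite (Hinj U' U k); assumption.
      * intros [_ H]. apply H; assumption.
    + replace (g k) with X; [apply (topology_full hT)|].
      apply set_ext. intro x. rewrite Hg. split; [|tauto].
      intro Hx. split; [exact Hx|]. intros U HU Hk. destruct N. exists U; auto.
  - intro x. rewrite HP. split.
    + intros [Hx H] n _. apply Hg. auto.
    + intro H. split.
      * specialize (H empty omega_0). apply Hg in H. tauto.
      * intros U HU. destruct (He U HU) as (k & Hk & Hek).
        specialize (H k Hk). apply Hg in H. destruct H as [_ H]. auto.
Qed.

End Topology.

Ltac definable_topology :=
  lazymatch goal with
  | |- fdef (fun e => way_below _ _ _) => apply fdef_way_below
  | _ => definable_products
  end.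

Ltac definable_extra ::= definable_topology.

Section Interpolation.

Context {M : structure} {hM : ZF M} {X T B : M}.
Context (hT : topology X T) (hH : hausdorff X T) (hL : locally_compact X T).
Context (hB : is_base T B).
(* The base is the union of the increasing sequence [beta] of finite sets. *)
Context (beta : M -> M) (beta_def : tdef (fun e => beta (e 0))).
Context (beta_finite : forall n, n ∈ omega -> kfinite (beta n)).
Context (beta_sub : forall n, beta n ⊆ B).
Context (beta_mono : forall m n, n ∈ omega -> m ∈ n -> beta m ⊆ beta n).
Context (beta_cover : forall b, b ∈ B -> exists n, n ∈ omega /\ b ∈ beta n).

(** The n-th canonical approximation of the open set [V] from inside. *)
Definition inner (n V : M) : M := bigcup (sep (beta n) (fun b => way_below T b V)).

Lemma tdef_inner (t u : env -> M) :
  tdef t -> tdef u -> tdef (fun e => inner (t e) (u e)).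
Proof.
  apply tdef_lift2. unfold inner. apply tdef_bigcup, tdef_sep; [|definability].
  apply (tdef_lift1 beta_def), tdef_var.
Qed.

Lemma in_inner (n V x : M) :
  x ∈ inner n V <-> exists b, b ∈ beta n /\ way_below T b V /\ x ∈ b.
Proof.
  unfold inner. rewrite in_bigcup. split.
  - intros (b & Hb & Hx). rewrite in_sep in Hb by definability. exists b; tauto.
  - intros (b & Hb & HV & Hx). exists b. rewrite in_sep by definability. auto.
Qed.

Lemma inner_open (n V : M) : inner n V ∈ T.
Proof.
  apply (open_bigcup hT). intros b Hb. rewrite in_sep in Hb by definability.
  apply (proj1 hB), (beta_sub (n := n)), Hb.
Qed.

Lemma inner_mono (m n V : M) : n ∈ omega -> m ∈ n -> inner m V ⊆ inner n V.
Proof.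
  intros Hn Hm x Hx. apply in_inner in Hx. destruct Hx as (b & Hb & H).
  apply in_inner. exists b. split; [|exact H]. apply (beta_mono Hn Hm Hb).
Qed.

Lemma inner_cover (V x : M) :
  V ∈ T -> x ∈ V -> exists n, n ∈ omega /\ x ∈ inner n V.
Proof.
  intros HV Hx. destruct (regular_base hT hH hL hB HV Hx) as (b & Hb & xb & W).
  destruct (beta_cover Hb) as (n & Hn & Hbn). exists n. split; [exact Hn|].
  apply in_inner. exists b; auto.
Qed.

Lemma inner_way_below (n V : M) : n ∈ omega -> way_below T (inner n V) V.
Proof.
  intro Hn. unfold inner.
  apply (kfinite_ind (P := fun Z => way_below T
    (bigcup (sep Z (fun b => way_below T b V))) V)) with (A := beta n).
  - definability.
  - apply beta_finite, Hn.
  - apply way_below_mono with (U := empty) (V := V);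
      [|intros x Hx; exact Hx|apply way_below_empty].
    intros x Hx. apply in_bigcup in Hx. destruct Hx as (b & Hb & _).
    rewrite in_sep in Hb by definability. destruct Hb as [Hb _].
    destruct (in_empty Hb).
  - intros Z a _ _ IH. destruct (classic (way_below T a V)) as [Ha|Ha].
    + eapply way_below_mono; [|intros x Hx; exact Hx|apply way_below_cup; [exact IH|exact Ha]].
      intros x Hx. apply in_bigcup in Hx. destruct Hx as (b & Hb & Hx).
      rewrite in_sep in Hb by definability. destruct Hb as [Hb Wb].
      apply in_cup. apply in_cup in Hb. destruct Hb as [Hb|Hb].
      * left. apply in_bigcup. exists b. rewrite in_sep by definability. auto.
      * right. apply in_sing in Hb. subst; exact Hx.
    + eapply way_below_mono; [|intros x Hx; exact Hx|exact IH].
      intros x Hx. apply in_bigcup in Hx. destruct Hx as (b & Hb & Hx).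
      rewrite in_sep in Hb by definability. destruct Hb as [Hb Wb].
      apply in_bigcup. exists b. rewrite in_sep by definability.
      apply in_cup in Hb. destruct Hb as [Hb|Hb]; [auto|].
      apply in_sing in Hb. subst; contradiction.
Qed.

(** By compactness, since the sets [inner n V] increase and cover [V]. *)
Lemma inner_interpolates (U V : M) :
  V ∈ T -> way_below T U V -> exists n, n ∈ omega /\ way_below T U (inner n V).
Proof.
  intros HV (K & HK & UK & KV).
  set (J := sep T (fun W => exists n, n ∈ omega /\ W ⊆ inner n V)).
  assert (HJ : forall W, W ∈ J <-> W ∈ T /\ exists n, n ∈ omega /\ W ⊆ inner n V).
  { intro W. unfold J. rewrite in_sep; [reflexivity|].
    apply fdef_ex, fdef_and; [definability|]. apply fdef_all, fdef_imp; [definability|].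
    apply fdef_mem; [definability|]. apply tdef_inner; definability. }
  destruct (HK J) as (W & HW & KW).
  - intros W HW. apply HJ in HW; tauto.
  - apply HJ. split; [apply (open_empty hT)|]. exists empty.
    split; [apply omega_0|]. intros x Hx; destruct (in_empty Hx).
  - intros W W' HW HW'. apply HJ in HW, HW'.
    destruct HW as (HW & n & Hn & A), HW' as (HW' & n' & Hn' & A').
    apply HJ. split; [apply (open_cup hT); assumption|].
    destruct (omega_trichotomy Hn Hn') as [L|[L|L]].
    + exists n'. split; [exact Hn'|]. intros x Hx. apply in_cup in Hx.
      destruct Hx; [apply (inner_mono Hn' L)|]; auto.
    + subst n'. exists n. split; [exact Hn|]. intros x Hx. apply in_cup in Hx.
      destruct Hx; auto.
    + exists n. split; [exact Hn|]. intros x Hx. apply in_cup in Hx.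
      destruct Hx; [|apply (inner_mono Hn L)]; auto.
  - intros x Hx. destruct (inner_cover HV (KV x Hx)) as (n & Hn & Hxn).
    exists (inner n V). split; [|exact Hxn]. apply HJ.
    split; [apply inner_open|]. exists n. split; [exact Hn|]. intros y Hy; exact Hy.
  - apply HJ in HW. destruct HW as (_ & n & Hn & A). exists n. split; [exact Hn|].
    exists K. split; [exact HK|]. split; [exact UK|]. intros x Hx. auto.
Qed.

(** The canonical interpolant between [U] and [V]: the first approximation of
    [V] that [U] is way below. *)
Definition interpolant (U V : M) : M :=
  the (fun W => exists n, n ∈ omega /\ W = inner n V /\ way_below T U W /\
                  forall m, m ∈ n -> ~ way_below T U (inner m V)).

Lemma tdef_interpolant (t u : env -> M) :
  tdef t -> tdef u -> tdef (fun e => interpolant (t e) (u e)).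
Proof.
  apply tdef_lift2. unfold interpolant. apply tdef_the, fdef_ex.
  apply fdef_and; [definability|].
  apply fdef_and; [apply fdef_eq; [definability|apply tdef_inner; definability]|].
  apply fdef_and; [definability|]. apply fdef_all, fdef_imp; [definability|].
  apply fdef_not, fdef_way_below; [definability|definability|].
  apply tdef_inner; definability.
Qed.

Lemma interpolant_spec (U V : M) :
  V ∈ T -> way_below T U V ->
  interpolant U V ∈ T /\ way_below T U (interpolant U V) /\
  way_below T (interpolant U V) V.
Proof.
  intros HV HU.
  destruct (least_number (P := fun n => way_below T U (inner n V)))
    as (n & Hn & W & L).
  - apply fdef_way_below; [definability|definability|apply tdef_inner; definability].
  - apply inner_interpolates; assumption.
  - replace (interpolant U V) with (inner n V).
    + split; [apply inner_open|]. split; [exact W|apply inner_way_below, Hn].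
    + symmetry. apply the_eq; [exists n; auto|].
      intros Z (m & Hm & -> & W' & L').
      destruct (omega_trichotomy Hn Hm) as [A|[A|A]].
      * destruct (L' n A W).
      * subst; reflexivity.
      * destruct (L m A W').
Qed.

(** * Families of pairs of open sets and their entourages *)

(* [P] is the intersection of the open sets [g n]. *)
Context (P : M) (g : M -> M) (g_def : tdef (fun e => g (e 0))).
Context (g_open : forall n, g n ∈ T).
Context (P_eq : forall x, x ∈ P <-> forall n, n ∈ omega -> x ∈ g n).

Ltac definable_open :=
  lazymatch goal with
  | |- tdef (fun e => inner _ _) => apply tdef_inner
  | |- tdef (fun e => interpolant _ _) => apply tdef_interpolant
  | |- tdef (fun e => beta _) => apply (tdef_lift1 beta_def)
  | |- tdef (fun e => g _) => apply (tdef_lift1 g_def)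
  | _ => definable_topology
  end.

Ltac definable_extra ::= definable_open.

(** A family of pairs ⟨U, V⟩ of open sets with [U] way below [V]. *)
Definition good (A : M) : Prop :=
  forall p, p ∈ A -> exists U V, p = opair U V /\ U ∈ T /\ V ∈ T /\ way_below T U V.

(** The entourage of a family: no pair of the family separates [y] from [z]. *)
Definition near (A y z : M) : Prop :=
  forall U V, opair U V ∈ A -> (y ∈ U -> z ∈ V) /\ (z ∈ U -> y ∈ V).

Lemma fdef_near (t u v : env -> M) :
  tdef t -> tdef u -> tdef v -> fdef (fun e => near (t e) (u e) (v e)).
Proof. apply fdef_lift3. unfold near. definability. Qed.

(** The three pairs ⟨U, W⟩, ⟨W, W'⟩, ⟨W', V⟩ obtained from a pair ⟨U, V⟩ by
    interpolating twice. *)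
Definition refine_pair (p : M) : M :=
  cup (cup (sing (opair (p1 p) (interpolant (p1 p) (p2 p))))
           (sing (opair (interpolant (p1 p) (p2 p))
                        (interpolant (interpolant (p1 p) (p2 p)) (p2 p)))))
      (sing (opair (interpolant (interpolant (p1 p) (p2 p)) (p2 p)) (p2 p))).

Lemma in_refine_pair (U V q : M) :
  q ∈ refine_pair (opair U V) <->
  q = opair U (interpolant U V) \/
  q = opair (interpolant U V) (interpolant (interpolant U V) V) \/
  q = opair (interpolant (interpolant U V) V) V.
Proof.
  unfold refine_pair. rewrite p1_opair, p2_opair, !in_cup, !in_sing. tauto.
Qed.

Lemma tdef_refine_pair (t : env -> M) :
  tdef t -> tdef (fun e => refine_pair (t e)).
Proof. apply tdef_lift1. unfold refine_pair. definability. Qed.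

Definition refine (A : M) : M :=
  sep (prod T T) (fun q => exists p, p ∈ A /\ q ∈ refine_pair p).

Lemma tdef_refine (t : env -> M) : tdef t -> tdef (fun e => refine (t e)).
Proof.
  apply tdef_lift1. unfold refine. apply tdef_sep; [definability|].
  apply fdef_ex, fdef_and; [definability|]. apply fdef_mem; [definability|].
  apply tdef_refine_pair; definability.
Qed.

Lemma in_refine (A q : M) :
  q ∈ refine A <-> q ∈ prod T T /\ exists p, p ∈ A /\ q ∈ refine_pair p.
Proof.
  unfold refine. rewrite in_sep; [reflexivity|].
  apply fdef_ex, fdef_and; [definability|]. apply fdef_mem; [definability|].
  apply tdef_refine_pair; definability.
Qed.

Lemma good_refine (A : M) : good A -> good (refine A).
Proof.
  intros HA q Hq. apply in_refine in Hq. destruct Hq as (_ & p & Hp & Hq).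
  destruct (HA p Hp) as (U & V & -> & HU & HV & W).
  destruct (interpolant_spec HV W) as (O1 & A1 & B1).
  destruct (interpolant_spec HV B1) as (O2 & A2 & B2).
  apply in_refine_pair in Hq. destruct Hq as [->|[->| ->]].
  - exists U, (interpolant U V). auto.
  - exists (interpolant U V), (interpolant (interpolant U V) V). auto.
  - exists (interpolant (interpolant U V) V), V. auto.
Qed.

(** The entourage of the refined family is a cube root of the given one. *)
Lemma near_refine (A x y z w : M) :
  good A -> near (refine A) x y -> near (refine A) y z -> near (refine A) z w ->
  near A x w.
Proof.
  intros HA N1 N2 N3 U V Hp.
  destruct (HA _ Hp) as (U' & V' & E & HU & HV & W).
  apply opair_inj in E. destruct E; subst U' V'.
  destruct (interpolant_spec HV W) as (O1 & A1 & B1).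
  destruct (interpolant_spec HV B1) as (O2 & A2 & B2).
  set (W1 := interpolant U V) in *. set (W2 := interpolant W1 V) in *.
  assert (R1 : opair U W1 ∈ refine A).
  { apply in_refine. rewrite opair_prod. split; [auto|].
    exists (opair U V). rewrite in_refine_pair. auto. }
  assert (R2 : opair W1 W2 ∈ refine A).
  { apply in_refine. rewrite opair_prod. split; [auto|].
    exists (opair U V). rewrite in_refine_pair. auto. }
  assert (R3 : opair W2 V ∈ refine A).
  { apply in_refine. rewrite opair_prod. split; [auto|].
    exists (opair U V). rewrite in_refine_pair. auto. }
  pose proof (N1 _ _ R1). pose proof (N2 _ _ R1). pose proof (N3 _ _ R1).
  pose proof (N1 _ _ R2). pose proof (N2 _ _ R2). pose proof (N3 _ _ R2).
  pose proof (N1 _ _ R3). pose proof (N2 _ _ R3). pose proof (N3 _ _ R3).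
  tauto.
Qed.

(** The pairs ⟨U, V⟩ of [A] such that [O] is neither contained in [U] nor
    disjoint from [V].  The other pairs put no condition on the points of [O],
    and neither do the pairs of their refinements. *)
Definition active (A O : M) : M :=
  sep A (fun p => ~ O ⊆ p1 p /\ exists z, z ∈ O /\ z ∈ p2 p).

Lemma in_active (A O p : M) :
  p ∈ active A O <-> p ∈ A /\ ~ O ⊆ p1 p /\ exists z, z ∈ O /\ z ∈ p2 p.
Proof. unfold active. rewrite in_sep by definability. reflexivity. Qed.

Lemma active_anti (A O O' : M) : O' ⊆ O -> active A O' ⊆ active A O.
Proof.
  intros H p Hp. apply in_active in Hp. destruct Hp as (Hp & N & z & Hz & Hz2).
  apply in_active. split; [exact Hp|]. split.
  - intro K. apply N. intros y Hy. auto.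
  - exists z; auto.
Qed.

(** Every point of [P] has a neighbourhood on which only finitely many pairs of
    [A] are active. *)
Definition locally_finite (A : M) : Prop :=
  forall x, x ∈ P -> exists O, O ∈ T /\ x ∈ O /\ kfinite (active A O).

Lemma locally_finite_cup (A A' : M) :
  locally_finite A -> locally_finite A' -> locally_finite (cup A A').
Proof.
  intros HA HA' x Hx. destruct (HA x Hx) as (O & HO & xO & F).
  destruct (HA' x Hx) as (O' & HO' & xO' & F').
  exists (cap O O'). split; [apply (open_cap hT); assumption|].
  split; [apply in_cap; auto|].
  apply kfinite_subset with (A := cup (active A O) (active A' O')).
  - apply kfinite_cup; assumption.
  - assert (S : cap O O' ⊆ O) by (intros y Hy; apply in_cap in Hy; tauto).
    assert (S' : cap O O' ⊆ O') by (intros y Hy; apply in_cap in Hy; tauto).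
    intros p Hp. apply in_active in Hp. destruct Hp as (Hp & H).
    apply in_cup in Hp. apply in_cup. destruct Hp as [Hp|Hp].
    + left. apply (active_anti S), in_active. auto.
    + right. apply (active_anti S'), in_active. auto.
Qed.

Lemma locally_finite_refine (A : M) :
  good A -> locally_finite A -> locally_finite (refine A).
Proof.
  intros HG HA x Hx. destruct (HA x Hx) as (O & HO & xO & F).
  exists O. split; [exact HO|]. split; [exact xO|].
  apply (kfinite_union (A := active A O) (t := refine_pair)).
  - apply tdef_refine_pair, tdef_var.
  - exact F.
  - intros p _. unfold refine_pair.
    apply kfinite_cup; [apply kfinite_cup|]; apply kfinite_sing.
  - intros q Hq. apply in_active in Hq. destruct Hq as (Hq & N & z & zO & Hz).
    apply in_refine in Hq. destruct Hq as (_ & p & Hp & Hq).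
    exists p. split; [|exact Hq].
    destruct (HG p Hp) as (U & V & -> & HU & HV & W).
    destruct (interpolant_spec HV W) as (O1 & A1 & B1).
    destruct (interpolant_spec HV B1) as (O2 & A2 & B2).
    apply way_below_sub in A1, B1, A2, B2, W.
    apply in_active. rewrite p1_opair, p2_opair. split; [exact Hp|].
    apply in_refine_pair in Hq. destruct Hq as [->|[->| ->]];
      rewrite p1_opair, p2_opair in *.
    + split; [exact N|]. exists z; auto.
    + split; [|exists z; auto]. intro S. apply N. intros y Hy; auto.
    + split; [|exists z; auto]. intro S. apply N. intros y Hy; auto.
Qed.

(** The entourage of a locally finite family is a neighbourhood of the
    diagonal of [P]. *)
Lemma near_open (A x : M) :
  good A -> locally_finite A -> x ∈ P ->
  exists O, O ∈ T /\ x ∈ O /\ forall y, y ∈ O -> near A x y.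
Proof.
  intros HG HA Hx. destruct (HA x Hx) as (O & HO & xO & F).
  assert (HxX : x ∈ X) by (apply (topology_sub hT HO), xO).
  assert (K : exists O', O' ∈ T /\ x ∈ O' /\ forall p y, p ∈ active A O ->
      y ∈ O' -> (x ∈ p1 p -> y ∈ p2 p) /\ (y ∈ p1 p -> x ∈ p2 p)).
  { apply (kfinite_ind (P := fun Z => exists O', O' ∈ T /\ x ∈ O' /\
      forall p y, p ∈ Z -> y ∈ O' ->
        (x ∈ p1 p -> y ∈ p2 p) /\ (y ∈ p1 p -> x ∈ p2 p))) with (A := active A O).
    - definability.
    - exact F.
    - exists O. split; [exact HO|]. split; [exact xO|].
      intros p y Hp; destruct (in_empty Hp).
    - intros Z a _ Ha (O' & HO' & xO' & IH).
      apply in_active in Ha. destruct Ha as [Ha _].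
      destruct (HG a Ha) as (U & V & -> & HU & HV & L & CL & UL & LV).
      assert (K : exists O1, O1 ∈ T /\ x ∈ O1 /\
        forall y, y ∈ O1 -> (x ∈ U -> y ∈ V) /\ (y ∈ U -> x ∈ V)).
      { destruct (classic (x ∈ V)) as [xV|xV]; [exists V; auto|].
        destruct (@separate_compact _ _ X T L x hT hH CL)
          as (O1 & W & HO1 & HW & xO1 & LW & dis).
        - intros y Hy. apply (topology_sub hT HV), LV, Hy.
        - exact HxX.
        - intro Hy. apply xV, LV, Hy.
        - exists O1. split; [exact HO1|]. split; [exact xO1|].
          intros y Hy. split; intro yU.
          + destruct xV. apply LV, UL, yU.
          + destruct (dis y). auto. }
      destruct K as (O1 & HO1 & xO1 & K).
      exists (cap O' O1). split; [apply (open_cap hT); assumption|].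
      split; [apply in_cap; auto|]. intros p y Hp Hy. apply in_cap in Hy.
      apply in_cup in Hp. destruct Hp as [Hp|Hp]; [apply IH; tauto|].
      apply in_sing in Hp; subst p. rewrite p1_opair, p2_opair. apply K; tauto. }
  destruct K as (O' & HO' & xO' & K). exists (cap O O').
  split; [apply (open_cap hT); assumption|]. split; [apply in_cap; auto|].
  intros y Hy U V Hp. apply in_cap in Hy. destruct Hy as [yO yO'].
  destruct (classic (opair U V ∈ active A O)) as [C|C].
  - specialize (K _ y C yO'). rewrite p1_opair, p2_opair in K. exact K.
  - destruct (HG _ Hp) as (U' & V' & E & _ & _ & W).
    apply opair_inj in E. destruct E; subst U' V'. apply way_below_sub in W.
    rewrite in_active, p1_opair, p2_opair in C.
    destruct (classic (O ⊆ U)) as [D|D]; [auto|].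
    assert (N : forall z, z ∈ O -> ~ z ∈ V).
    { intros z zO zV. apply C. split; [exact Hp|]. split; [exact D|].
      exists z; auto. }
    split; intro H.
    + destruct (N x xO). auto.
    + destruct (N y yO). auto.
Qed.

(** The pairs added at stage [k]: the first ones make the entourages small, the
    others, which exhaust [g k] by sets way below it, serve completeness. *)
Definition base_pairs (k : M) : M :=
  sep (prod T T) (fun q =>
    (exists b, b ∈ beta k /\ q = opair (inner k b) b) \/
    (exists n, n ∈ omega /\
       q = opair (inner n (g k)) (interpolant (inner n (g k)) (g k)))).

Lemma in_base_pairs (k q : M) :
  q ∈ base_pairs k <-> q ∈ prod T T /\
    ((exists b, b ∈ beta k /\ q = opair (inner k b) b) \/
     (exists n, n ∈ omega /\
        q = opair (inner n (g k)) (interpolant (inner n (g k)) (g k)))).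
Proof. unfold base_pairs. rewrite in_sep by definability. reflexivity. Qed.

Lemma tdef_base_pairs (t : env -> M) : tdef t -> tdef (fun e => base_pairs (t e)).
Proof. apply tdef_lift1. unfold base_pairs. definability. Qed.

Lemma beta_open (n b : M) : b ∈ beta n -> b ∈ T.
Proof. intro H. apply (proj1 hB), (beta_sub H). Qed.

Lemma good_base_pairs (k : M) : k ∈ omega -> good (base_pairs k).
Proof.
  intros Hk q Hq. apply in_base_pairs in Hq.
  destruct Hq as [_ [(b & Hb & ->)|(n & Hn & ->)]].
  - exists (inner k b), b. split; [reflexivity|].
    split; [apply inner_open|]. split; [apply (beta_open Hb)|].
    apply inner_way_below, Hk.
  - destruct (interpolant_spec (g_open k) (inner_way_below (g k) Hn)) as (O1 & A1 & _).
    eexists _, _. split; [reflexivity|]. split; [apply inner_open|]. auto.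
Qed.

Lemma locally_finite_base_pairs (k : M) :
  k ∈ omega -> locally_finite (base_pairs k).
Proof.
  intros Hk x Hx.
  destruct (inner_cover (g_open k) (proj1 (P_eq x) Hx k Hk)) as (n & Hn & xn).
  exists (inner n (g k)). split; [apply inner_open|]. split; [exact xn|].
  set (h1 := fun b => sing (opair (inner k b) b)).
  set (h2 := fun m => sing (opair (inner m (g k)) (interpolant (inner m (g k)) (g k)))).
  set (S := active (base_pairs k) (inner n (g k))).
  apply kfinite_subset with
    (A := cup (sep S (fun q => exists b, b ∈ beta k /\ q ∈ h1 b))
              (sep S (fun q => exists m, m ∈ n /\ q ∈ h2 m))).
  - apply kfinite_cup.
    + apply (kfinite_union (A := beta k) (t := h1)).
      * unfold h1. definability.
      * apply beta_finite, Hk.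
      * intros b _. apply kfinite_sing.
      * intros q Hq. unfold h1 in *. rewrite in_sep in Hq by definability. tauto.
    + apply (kfinite_union (A := n) (t := h2)).
      * unfold h2. definability.
      * apply kfinite_number, Hn.
      * intros b _. apply kfinite_sing.
      * intros q Hq. unfold h2 in *. rewrite in_sep in Hq by definability. tauto.
  - intros q Hq. unfold h1, h2. rewrite in_cup, !in_sep by definability.
    pose proof Hq as H. apply in_active in H. destruct H as (H & N & _).
    apply in_base_pairs in H. destruct H as [_ [(b & Hb & ->)|(m & Hm & ->)]].
    + left. split; [exact Hq|]. exists b. rewrite in_sing. auto.
    + right. split; [exact Hq|]. exists m. rewrite in_sing. split; [|reflexivity].
      rewrite p1_opair in N.
      destruct (omega_trichotomy Hm Hn) as [L|[L|L]]; [exact L| |].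
      * subst m. destruct N. intros y Hy; exact Hy.
      * destruct N. apply (inner_mono Hm L).
Qed.

(** The families of pairs that define the entourages, from coarse to fine. *)
Definition family (k : M) : M :=
  rec empty (fun i A => cup (refine A) (base_pairs i)) k.

Lemma family_step_def :
  tdef (fun e : env => cup (refine (e 1)) (base_pairs (e 0))).
Proof.
  apply tdef_cup; [apply tdef_refine, tdef_var|apply tdef_base_pairs, tdef_var].
Qed.

Lemma tdef_family (t : env -> M) : tdef t -> tdef (fun e => family (t e)).
Proof.
  apply (@tdef_rec _ _ empty (fun i A => cup (refine A) (base_pairs i)) family_step_def).
Qed.

Lemma family_0 : family empty = empty.
Proof.
  apply (@rec_0 _ _ empty (fun i A => cup (refine A) (base_pairs i)) family_step_def).
Qed.

Lemma family_S (k : M) :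
  k ∈ omega -> family (succ k) = cup (refine (family k)) (base_pairs k).
Proof.
  apply (@rec_S _ _ empty (fun i A => cup (refine A) (base_pairs i)) family_step_def).
Qed.

Lemma family_good (k : M) : k ∈ omega -> good (family k).
Proof.
  revert k. apply omega_ind.
  - unfold good. apply fdef_all, fdef_imp; [|definability].
    apply fdef_mem; [definability|apply tdef_family; definability].
  - rewrite family_0. intros p Hp; destruct (in_empty Hp).
  - intros k Hk IH. rewrite (family_S Hk). intros p Hp. apply in_cup in Hp.
    destruct Hp as [Hp|Hp]; [apply (good_refine IH Hp)|apply (good_base_pairs Hk Hp)].
Qed.

Lemma family_locally_finite (k : M) : k ∈ omega -> locally_finite (family k).
Proof.
  revert k. apply omega_ind.
  - unfold locally_finite, active. apply fdef_all, fdef_imp; [definability|].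
    apply fdef_ex, fdef_and; [definability|]. apply fdef_and; [definability|].
    apply fdef_kfinite, tdef_sep; [apply tdef_family; definability|definability].
  - rewrite family_0. intros x Hx. exists X.
    split; [apply (topology_full hT)|]. split.
    + apply (topology_sub hT (g_open empty)), P_eq; [exact Hx|apply omega_0].
    + apply kfinite_subset with (A := empty); [apply kfinite_empty|].
      intros p Hp. apply in_active in Hp. tauto.
  - intros k Hk IH. rewrite (family_S Hk). apply locally_finite_cup.
    + apply locally_finite_refine; [apply family_good, Hk|exact IH].
    + apply locally_finite_base_pairs, Hk.
Qed.

(** The k-th entourage. *)
Definition entourage (k x y : M) : Prop := near (family k) x y.

Lemma entourage_def : fdef (fun e : env => entourage (e 0) (e 1) (e 2)).
Proof. apply fdef_near; [apply tdef_family|..]; definability. Qed.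

Lemma entourage_0 (x y : M) : entourage empty x y.
Proof. unfold entourage. rewrite family_0. intros U V H; destruct (in_empty H). Qed.

Lemma entourage_refl (k x : M) : k ∈ omega -> entourage k x x.
Proof.
  intros Hk U V H. destruct (family_good Hk H) as (U' & V' & E & _ & _ & W).
  apply opair_inj in E. destruct E; subst U' V'. apply way_below_sub in W. auto.
Qed.

Lemma entourage_sym (k x y : M) : entourage k x y -> entourage k y x.
Proof. intros H U V K. specialize (H U V K). tauto. Qed.

Lemma entourage_cube (k x y z w : M) :
  k ∈ omega -> entourage (succ k) x y -> entourage (succ k) y z ->
  entourage (succ k) z w -> entourage k x w.
Proof.
  intros Hk. unfold entourage. rewrite (family_S Hk). intros N1 N2 N3.
  apply near_refine with (y := y) (z := z); [apply family_good, Hk| | |];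
    intros U V H; [apply N1|apply N2|apply N3]; apply in_cup; auto.
Qed.

Lemma entourage_open (k x : M) :
  k ∈ omega -> x ∈ P ->
  exists O, O ∈ T /\ x ∈ O /\ forall y, y ∈ O -> entourage k x y.
Proof.
  intros Hk Hx.
  apply near_open; [apply family_good|apply family_locally_finite|]; assumption.
Qed.

Lemma entourage_small (O x : M) :
  O ∈ T -> x ∈ O ->
  exists k, k ∈ omega /\ forall y, entourage k x y -> y ∈ O.
Proof.
  intros HO Hx. destruct (regular_base hT hH hL hB HO Hx) as (b & Hb & xb & W).
  pose proof (proj1 hB b Hb) as bT.
  destruct (beta_cover Hb) as (m & Hm & bm).
  destruct (inner_cover bT xb) as (n & Hn & xn).
  assert (K : exists k, k ∈ omega /\ b ∈ beta k /\ x ∈ inner k b).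
  { destruct (omega_trichotomy Hm Hn) as [L|[L|L]].
    - exists n. split; [exact Hn|]. split; [apply (beta_mono Hn L bm)|exact xn].
    - subst n. exists m; auto.
    - exists m. split; [exact Hm|]. split; [exact bm|apply (inner_mono Hm L xn)]. }
  destruct K as (k & Hk & bk & xk).
  exists (succ k). split; [apply omega_S, Hk|]. intros y N.
  apply (way_below_sub W). apply (N (inner k b) b); [|exact xk].
  rewrite (family_S Hk). apply in_cup; right. apply in_base_pairs.
  split; [apply opair_prod; split; [apply inner_open|exact bT]|].
  left. exists b; auto.
Qed.

(** The points near [x] at stage n + 1 stay way below [g n]. *)
Lemma entourage_compact (n x : M) :
  n ∈ omega -> x ∈ P ->
  exists V, way_below T V (g n) /\ forall y, entourage (succ n) x y -> y ∈ V.
Proof.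
  intros Hn Hx.
  destruct (inner_cover (g_open n) (proj1 (P_eq x) Hx n Hn)) as (m & Hm & xm).
  destruct (interpolant_spec (g_open n) (inner_way_below (g n) Hm)) as (O1 & _ & B1).
  exists (interpolant (inner m (g n)) (g n)). split; [exact B1|].
  intros y N. apply (N (inner m (g n)) _); [|exact xm].
  rewrite (family_S Hn). apply in_cup; right. apply in_base_pairs.
  split; [apply opair_prod; split; [apply inner_open|exact O1]|].
  right. exists m; auto.
Qed.

End Interpolation.
(** * Arithmetic in a complete ordered field *)

Section Reals.

Context {M : structure} {hM : ZF M} {R : ordered_structure M}.
Context (hR : complete_ordered_field R).

Local Notation "x ≼ y" := (app (le R) x y) (at level 70, no associativity).

Lemma fdef_app (t u v : env -> M) :
  tdef t -> tdef u -> tdef v -> fdef (fun e => app (t e) (u e) (v e)).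
Proof.
  intros Ht Hu Hv.
  apply fdef_ext with (P := fun e => opair (u e) (v e) ∈ t e).
  - intro e. symmetry. apply app_opair.
  - repeat first [assumption | apply fdef_mem | apply tdef_opair].
Qed.

Lemma fdef_app2 (t u v w : env -> M) :
  tdef t -> tdef u -> tdef v -> tdef w ->
  fdef (fun e => app2 (t e) (u e) (v e) (w e)).
Proof.
  intros Ht Hu Hv Hw.
  apply fdef_ext with (P := fun e => opair (opair (u e) (v e)) (w e) ∈ t e).
  - intro e. symmetry. apply app2_opair.
  - repeat first [assumption | apply fdef_mem | apply tdef_opair].
Qed.

Lemma function2_total (f a b c x y : M) :
  function2 f a b c -> x ∈ a -> y ∈ b -> exists! z, app2 f x y z.
Proof.
  intros (q & Hq & [[_ H] _]) Hx Hy. apply is_product_eq in Hq; subst q.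
  destruct (H (opair x y)) as (z & Hz & U); [apply opair_prod; auto|].
  exists z. split.
  - apply app2_opair, app_opair, Hz.
  - intros z' Hz'. apply U, app_opair, app2_opair, Hz'.
Qed.

Lemma function2_dom (f a b c x y z : M) :
  function2 f a b c -> app2 f x y z -> x ∈ a /\ y ∈ b /\ z ∈ c.
Proof.
  intros (q & Hq & [[H _] H3]) Hz. apply is_product_eq in Hq; subst q.
  apply app2_opair in Hz. destruct (H _ Hz) as (p & z' & Hp & E).
  apply is_opair_eq, opair_inj in E. destruct E; subst p z'.
  apply opair_prod in Hp. split; [tauto|]. split; [tauto|].
  apply (H3 (opair x y)), app_opair, Hz.
Qed.

(** Addition as an operation on elements of the model. *)
Definition sum (x y : M) : M := the (fun z => app2 (add R) x y z).

Lemma tdef_sum (t u : env -> M) :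
  tdef t -> tdef u -> tdef (fun e => sum (t e) (u e)).
Proof.
  apply tdef_lift2. unfold sum. apply tdef_the, fdef_app2; definability.
Qed.

Lemma sum_app2 (x y : M) : x ∈ points R -> y ∈ points R -> app2 (add R) x y (sum x y).
Proof.
  intros Hx Hy. apply (the_spec (P := fun z => app2 (add R) x y z)).
  apply (function2_total (add_function hR) Hx Hy).
Qed.

Lemma app2_sum (x y z : M) : app2 (add R) x y z -> z = sum x y.
Proof.
  intro H. destruct (function2_dom (add_function hR) H) as (Hx & Hy & _).
  destruct (function2_total (add_function hR) Hx Hy) as (u & _ & U).
  transitivity u; [symmetry|]; apply U; [exact H|apply sum_app2; assumption].
Qed.

Lemma sum_point (x y : M) : x ∈ points R -> y ∈ points R -> sum x y ∈ points R.
Proof.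
  intros Hx Hy. apply (function2_dom (add_function hR) (sum_app2 Hx Hy)).
Qed.

Lemma sum_comm (x y : M) : x ∈ points R -> y ∈ points R -> sum x y = sum y x.
Proof. intros Hx Hy. apply app2_sum, (add_comm hR), sum_app2; assumption. Qed.

Lemma sum_assoc (x y z : M) :
  x ∈ points R -> y ∈ points R -> z ∈ points R ->
  sum (sum x y) z = sum x (sum y z).
Proof.
  intros Hx Hy Hz. apply app2_sum.
  apply (add_assoc hR (x := x) (y := y) (z := z) (u := sum x y));
    apply sum_app2; auto using sum_point.
Qed.

Lemma sum_zero (x : M) : x ∈ points R -> sum x (zero R) = x.
Proof. intro Hx. symmetry. apply app2_sum, (add_zero hR), Hx. Qed.

Lemma zero_sum (x : M) : x ∈ points R -> sum (zero R) x = x.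
Proof.
  intro Hx. rewrite sum_comm; [apply sum_zero, Hx|apply (zero_point hR)|exact Hx].
Qed.

Lemma le_reflexive (x : M) : x ∈ points R -> x ≼ x.
Proof. intro Hx. destruct (le_total hR Hx Hx); assumption. Qed.

Lemma le_sum (x y z : M) :
  x ∈ points R -> y ∈ points R -> z ∈ points R -> x ≼ y -> sum x z ≼ sum y z.
Proof.
  intros Hx Hy Hz H.
  apply (le_add hR Hx Hy H (z := z)); apply sum_app2; assumption.
Qed.

Lemma le_sum2 (x y z w : M) :
  x ∈ points R -> y ∈ points R -> z ∈ points R -> w ∈ points R ->
  x ≼ y -> z ≼ w -> sum x z ≼ sum y w.
Proof.
  intros Hx Hy Hz Hw H K. apply (le_trans hR) with (y := sum y z);
    auto using sum_point, le_sum.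
  rewrite (sum_comm Hy Hz), (sum_comm Hy Hw). apply le_sum; assumption.
Qed.

Lemma opposite (x : M) :
  x ∈ points R -> exists y, y ∈ points R /\ sum x y = zero R.
Proof.
  intro Hx. destruct (add_opp hR Hx) as (y & Hy & H). exists y.
  split; [exact Hy|]. symmetry. apply app2_sum, H.
Qed.

Lemma le_cancel (x y z : M) :
  x ∈ points R -> y ∈ points R -> z ∈ points R -> sum x z ≼ sum y z -> x ≼ y.
Proof.
  intros Hx Hy Hz H. destruct (opposite Hz) as (w & Hw & E).
  assert (A : forall v, v ∈ points R -> sum (sum v z) w = v).
  { intros v Hv. rewrite sum_assoc, E, sum_zero; auto. }
  rewrite <- (A x Hx), <- (A y Hy). apply le_sum; auto using sum_point.
Qed.

Lemma lt_not_le (x y : M) :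
  x ∈ points R -> y ∈ points R -> (lt R x y <-> ~ y ≼ x).
Proof.
  intros Hx Hy. split.
  - intros [A N] B. apply N. apply (le_antisym hR); assumption.
  - intro N. split.
    + destruct (le_total hR Hx Hy); [assumption|contradiction].
    + intros ->. apply N, le_reflexive, Hy.
Qed.

Lemma not_le_le (x y : M) : x ∈ points R -> y ∈ points R -> ~ x ≼ y -> y ≼ x.
Proof. intros Hx Hy N. destruct (le_total hR Hx Hy); tauto. Qed.

(** The only use of multiplication in the field. *)
Lemma halving :
  exists half : M -> M, tdef (fun e => half (e 0)) /\
    forall x, x ∈ points R -> half x ∈ points R /\ sum (half x) (half x) = x.
Proof.
  pose proof (zero_point hR) as P0. pose proof (one_point hR) as P1.
  assert (N : sum (one R) (one R) <> zero R).
  { intro E. apply (one_neq_zero hR).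
    destruct (le_total hR P0 P1) as [H|H].
    - apply (le_antisym hR); try assumption.
      rewrite <- E. rewrite <- (zero_sum P1) at 1. apply le_sum; assumption.
    - apply (le_antisym hR); try assumption.
      rewrite <- E. rewrite <- (zero_sum P1) at 3. apply le_sum; assumption. }
  destruct (mul_inv hR (sum_point P1 P1) N) as (i & Hi & Hinv).
  exists (fun x => the (fun z => app2 (mul R) x i z)). split.
  - apply tdef_the, fdef_app2; definability.
  - intros x Hx.
    assert (A : forall y, y ∈ points R ->
      app2 (mul R) y i (the (fun z => app2 (mul R) y i z))).
    { intros y Hy. apply (the_spec (P := fun z => app2 (mul R) y i z)).
      apply (function2_total (mul_function hR) Hy Hi). }
    set (z := the (fun z => app2 (mul R) x i z)).
    assert (Hz : z ∈ points R) by apply (function2_dom (mul_function hR) (A x Hx)).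
    split; [exact Hz|].
    (* i * (1 + 1) = 1, so i + i = 1 and x * (i + i) = x. *)
    assert (E : sum i i = one R).
    { symmetry. apply app2_sum.
      apply (mul_add hR (x := i) (y := one R) (z := one R) (u := sum (one R) (one R))).
      - apply sum_app2; assumption.
      - apply (mul_comm hR), Hinv.
      - apply (mul_one hR), Hi.
      - apply (mul_one hR), Hi. }
    symmetry. apply app2_sum.
    apply (mul_add hR (x := x) (y := i) (z := i) (u := one R)).
    + rewrite <- E. apply sum_app2; assumption.
    + apply (mul_one hR), Hx.
    + apply A, Hx.
    + apply A, Hx.
Qed.

Lemma double_le (x y : M) :
  x ∈ points R -> y ∈ points R -> sum x x ≼ sum y y -> x ≼ y.
Proof.
  intros Hx Hy H. destruct (le_total hR Hx Hy) as [A|A]; [exact A|].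
  apply le_cancel with (z := x); try assumption.
  apply (le_trans hR) with (y := sum y y); auto using sum_point.
  rewrite (sum_comm Hy Hx). apply le_sum; assumption.
Qed.

(** There is a sequence of positive reals, each half of the preceding one; by
    completeness it tends to 0. *)
Lemma halving_sequence :
  exists h : M -> M, tdef (fun e => h (e 0)) /\
    (forall k, k ∈ omega -> h k ∈ points R /\ ~ h k ≼ zero R /\
       sum (h (succ k)) (h (succ k)) = h k) /\
    (forall eps, eps ∈ points R -> ~ eps ≼ zero R ->
       exists k, k ∈ omega /\ ~ eps ≼ h k).
Proof.
  pose proof (zero_point hR) as P0. pose proof (one_point hR) as P1.
  destruct halving as (half & Hd & Hh).
  assert (C : exists c, c ∈ points R /\ ~ c ≼ zero R).
  { destruct (classic (one R ≼ zero R)) as [L|L]; [|exists (one R); auto].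
    destruct (opposite P1) as (o & Ho & E). exists o. split; [exact Ho|]. intro L'.
    apply (one_neq_zero hR). apply (le_antisym hR); try assumption.
    rewrite <- E. rewrite <- (sum_zero P1) at 2.
    rewrite (sum_comm P1 Ho), (sum_comm P1 P0). apply le_sum; assumption. }
  destruct C as (c & Hc & Pc).
  assert (D : tdef (fun e : env => (fun _ y => half y) (e 0) (e 1))).
  { apply (tdef_lift1 Hd), tdef_var. }
  set (h := rec c (fun _ y => half y)).
  assert (h0 : h empty = c) by apply (rec_0 c D).
  assert (hS : forall k, k ∈ omega -> h (succ k) = half (h k)).
  { intros k Hk. apply (@rec_S _ _ c (fun _ y => half y) D k Hk). }
  assert (hd : forall t : env -> M, tdef t -> tdef (fun e => h (t e))).
  { intros t Ht. apply (@tdef_rec _ _ c (fun _ y => half y) D t Ht). }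
  assert (hP : forall k, k ∈ omega -> h k ∈ points R /\ ~ h k ≼ zero R).
  { apply omega_ind.
    - apply fdef_and.
      + apply fdef_mem; [apply hd|]; definability.
      + apply fdef_not, fdef_app; [|apply hd|]; definability.
    - rewrite h0. auto.
    - intros k Hk [IH N]. rewrite (hS k Hk). destruct (Hh _ IH) as [A E].
      split; [exact A|]. intro L. apply N. rewrite <- E.
      rewrite <- (sum_zero P0). apply le_sum2; assumption. }
  assert (hE : forall k, k ∈ omega -> sum (h (succ k)) (h (succ k)) = h k).
  { intros k Hk. rewrite (hS k Hk). apply Hh, hP, Hk. }
  exists h. split; [apply hd, tdef_var|]. split.
  - intros k Hk. destruct (hP k Hk). auto.
  - intros eps Heps Pe. apply NNPP. intro N.
    assert (G : forall k, k ∈ omega -> eps ≼ h k).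
    { intros k Hk. apply NNPP. intro A. apply N. exists k; auto. }
    set (L := sep (points R) (fun r => forall k, k ∈ omega -> r ≼ h k)).
    assert (HL : forall r, r ∈ L <-> r ∈ points R /\ forall k, k ∈ omega -> r ≼ h k).
    { intro r. unfold L. rewrite in_sep; [reflexivity|].
      apply fdef_all, fdef_imp; [definability|]. apply fdef_app; [|definability|];
        [definability|apply hd; definability]. }
    (* The infimum s of the sequence satisfies 2s <= s. *)
    destruct (sup_complete hR (A := L)) as (s & [Hs U] & Hleast).
    + intros r Hr. apply HL in Hr. tauto.
    + exists eps. apply HL. auto.
    + exists (h empty). split; [apply hP, omega_0|].
      intros r Hr. apply HL in Hr. apply Hr, omega_0.
    + assert (B : forall k, k ∈ omega -> s ≼ h k).
      { intros k Hk. apply Hleast. split; [apply hP, Hk|].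
        intros r Hr. apply HL in Hr. apply Hr, Hk. }
      assert (SL : sum s s ∈ L).
      { apply HL. split; [apply sum_point; assumption|]. intros k Hk.
        rewrite <- (hE k Hk).
        apply le_sum2; try assumption; try (apply hP, omega_S, Hk);
          apply B, omega_S, Hk. }
      apply U in SL. apply Pe.
      apply (le_trans hR) with (y := s); try assumption.
      * apply U, HL. auto.
      * apply le_cancel with (z := s); try assumption. rewrite zero_sum; assumption.
Qed.

End Reals.
Ltac definable_reals :=
  lazymatch goal with
  | |- fdef (fun e => app _ _ _) => apply fdef_app
  | |- tdef (fun e => sum _ _) => apply tdef_sum
  | _ => definable_topology
  end.

Ltac definable_extra ::= definable_reals.

(** * Metrization *)

Section Metrization.

Context {M : structure} {hM : ZF M} {R : ordered_structure M}.
Context (hR : complete_ordered_field R).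

Local Notation "x ≼ y" := (app (le R) x y) (at level 70, no associativity).

(* [E k] is the k-th entourage, and [h k] the cost of a step inside it. *)
Context (h : M -> M) (h_def : tdef (fun e => h (e 0))).
Context (h_spec : forall k, k ∈ omega -> h k ∈ points R /\ ~ h k ≼ zero R /\
  sum (R := R) (h (succ k)) (h (succ k)) = h k).

Context (Y : M) (E : M -> M -> M -> Prop).
Context (E_def : fdef (fun e => E (e 0) (e 1) (e 2))).
Context (E_0 : forall x y, E empty x y).
Context (E_refl : forall k x, k ∈ omega -> E k x x).
Context (E_sym : forall k x y, E k x y -> E k y x).
Context (E_cube : forall k x y z w, k ∈ omega ->
  E (succ k) x y -> E (succ k) y z -> E (succ k) z w -> E k x w).

Ltac definable_metric :=
  lazymatch goal with
  | |- tdef (fun e => h _) => apply (tdef_lift1 h_def)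
  | |- fdef (fun e => E _ _ _) => apply (fdef_lift3 E_def)
  | _ => definable_reals
  end.

Ltac definable_extra ::= definable_metric.

Let P0 : zero R ∈ points R := zero_point hR.
Let le_refl (x : M) (Hx : x ∈ points R) : x ≼ x := le_reflexive hR Hx.
Let sum_pt (x y : M) (Hx : x ∈ points R) (Hy : y ∈ points R) :
  sum (R := R) x y ∈ points R := sum_point hR Hx Hy.

Lemma scale_point (k : M) : k ∈ omega -> h k ∈ points R.
Proof. apply h_spec. Qed.

Lemma scale_nonneg (k : M) : k ∈ omega -> zero R ≼ h k.
Proof.
  intro Hk. destruct (h_spec Hk) as (A & B & _). apply (not_le_le hR A P0 B).
Qed.

Lemma scale_double (k : M) :
  k ∈ omega -> sum (R := R) (h (succ k)) (h (succ k)) = h k.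
Proof. apply h_spec. Qed.

Lemma scale_step (k : M) : k ∈ omega -> h (succ k) ≼ h k.
Proof.
  intro Hk. pose proof (omega_S Hk) as HS.
  rewrite <- (scale_double Hk).
  rewrite <- (sum_zero hR (scale_point HS)) at 1.
  apply (le_sum2 hR); auto using scale_point, scale_nonneg, le_refl.
Qed.

Lemma scale_anti (j k : M) : k ∈ omega -> j ∈ k -> h k ≼ h j.
Proof.
  intros Hk. revert j. revert k Hk.
  apply (omega_ind (P := fun k => forall j, j ∈ k -> h k ≼ h j)).
  - definability.
  - intros j H; destruct (in_empty H).
  - intros k Hk IH j Hj. apply in_succ in Hj. destruct Hj as [Hj|Hj].
    + apply (le_trans hR) with (y := h k); auto using scale_point, omega_S, scale_step.
      apply scale_point, (omega_elem Hk Hj).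
    + subst; apply scale_step, Hk.
Qed.

Lemma E_step (k x y : M) : k ∈ omega -> E (succ k) x y -> E k x y.
Proof.
  intros Hk H. apply E_cube with (y := y) (z := y); auto using omega_S.
Qed.

Lemma E_anti (j k x y : M) : k ∈ omega -> j ∈ k -> E k x y -> E j x y.
Proof.
  intros Hk. revert j x y. revert k Hk.
  apply (omega_ind (P := fun k => forall j x y, j ∈ k -> E k x y -> E j x y)).
  - definability.
  - intros j x y H; destruct (in_empty H).
  - intros k Hk IH j x y Hj H. apply E_step in H; [|exact Hk].
    apply in_succ in Hj. destruct Hj as [Hj|Hj]; [eauto|subst; exact H].
Qed.

(** A step that costs strictly less than [h k] lies in the entourage k + 1. *)
Lemma E_scale (j k x y : M) :
  j ∈ omega -> k ∈ omega -> ~ h k ≼ h j -> E j x y -> E (succ k) x y.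
Proof.
  intros Hj Hk N H.
  assert (L : k ∈ j).
  { destruct (omega_trichotomy Hj Hk) as [L|[L|L]]; [| |exact L].
    - destruct N. apply scale_anti; assumption.
    - subst k. destruct N. apply (le_reflexive hR), scale_point, Hj. }
  apply (succ_mono Hj) in L. apply in_succ in L.
  destruct L as [L|L]; [apply (E_anti Hj L H)|rewrite L; exact H].
Qed.

(** [chain n] consists of the triples ⟨⟨x, y⟩, a⟩ such that [y] is reached from
    [x] by at most [n] steps of total cost [a]; a step inside the k-th entourage
    costs [h k]. *)
Definition chain0 : M :=
  sep (prod (prod Y Y) (points R)) (fun q => exists x, q = opair (opair x x) (zero R)).

Definition chain_step (A : M) : M :=
  sep (prod (prod Y Y) (points R)) (fun q => q ∈ A \/
    exists x y z a k, q = opair (opair x z) (sum (R := R) a (h k)) /\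
      opair (opair x y) a ∈ A /\ k ∈ omega /\ E k y z).

Definition chain (n : M) : M := rec chain0 (fun _ A => chain_step A) n.

Lemma chain_step_def : tdef (fun e : env => (fun _ A => chain_step A) (e 0) (e 1)).
Proof. unfold chain_step. definability. Qed.

Lemma tdef_chain (t : env -> M) : tdef t -> tdef (fun e => chain (t e)).
Proof. apply (@tdef_rec _ _ chain0 (fun _ A => chain_step A) chain_step_def). Qed.

(** [y] is reached from [x] by at most [n] steps of total cost [a]. *)
Definition cost (n x y a : M) : Prop := opair (opair x y) a ∈ chain n.

Lemma cost_0 (x y a : M) :
  cost empty x y a <-> x ∈ Y /\ x = y /\ a = zero R.
Proof.
  unfold cost, chain. rewrite (@rec_0 _ _ chain0 (fun _ A => chain_step A) chain_step_def).
  unfold chain0. rewrite in_sep by definability. rewrite !opair_prod. split.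
  - intros (((Hx & _) & _) & z & Eq). apply opair_inj in Eq. destruct Eq as [Eq Ea].
    apply opair_inj in Eq. destruct Eq; subst; auto.
  - intros (Hx & <- & ->). split; [auto|]. exists x; reflexivity.
Qed.

Lemma cost_S (n x z c : M) :
  n ∈ omega -> (cost (succ n) x z c <->
    (x ∈ Y /\ z ∈ Y /\ c ∈ points R) /\
    (cost n x z c \/ exists y a k,
       c = sum (R := R) a (h k) /\ cost n x y a /\ k ∈ omega /\ E k y z)).
Proof.
  intro Hn. unfold cost, chain.
  rewrite (@rec_S _ _ chain0 (fun _ A => chain_step A) chain_step_def n Hn).
  fold (chain n). unfold chain_step at 1.
  rewrite in_sep by definability. rewrite !opair_prod. split.
  - intros (((Hx & Hz) & Hc) & H). split; [auto|]. destruct H as [H|H]; [auto|].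
    destruct H as (x' & y & z' & a & k & Eq & H). right. exists y, a, k.
    apply opair_inj in Eq. destruct Eq as [Eq Ea].
    apply opair_inj in Eq. destruct Eq; subst; auto.
  - intros ((Hx & Hz & Hc) & H). split; [auto|]. destruct H as [H|H]; [auto|].
    destruct H as (y & a & k & -> & H). right. exists x, y, z, a, k. auto.
Qed.

Lemma cost_dom (n x y a : M) :
  n ∈ omega -> cost n x y a -> x ∈ Y /\ y ∈ Y /\ a ∈ points R.
Proof.
  intro Hn. revert n Hn x y a.
  apply (omega_ind (P := fun n => forall x y a, cost n x y a ->
    x ∈ Y /\ y ∈ Y /\ a ∈ points R)).
  - unfold cost. do 3 apply fdef_all. apply fdef_imp; [|definability].
    apply fdef_mem; [definability|apply tdef_chain; definability].
  - intros x y a H. apply cost_0 in H. destruct H as (Hx & <- & ->). auto.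
  - intros n Hn _ x y a H. apply (cost_S x y a Hn) in H. tauto.
Qed.

Lemma cost_more (n x y a : M) : n ∈ omega -> cost n x y a -> cost (succ n) x y a.
Proof.
  intros Hn H. apply (cost_S x y a Hn). split; [apply (cost_dom Hn H)|auto].
Qed.

Lemma cost_add (n x y z a k : M) :
  n ∈ omega -> cost n x y a -> k ∈ omega -> z ∈ Y -> E k y z ->
  cost (succ n) x z (sum (R := R) a (h k)).
Proof.
  intros Hn H Hk Hz He. destruct (cost_dom Hn H) as (Hx & Hy & Ha).
  apply (cost_S x z _ Hn). split.
  - auto using sum_pt, scale_point.
  - right. exists y, a, k. auto.
Qed.

Lemma cost_refl (n x : M) : n ∈ omega -> x ∈ Y -> cost n x x (zero R).
Proof.
  intros Hn Hx. revert n Hn. apply (omega_ind (P := fun n => cost n x x (zero R))).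
  - unfold cost. apply fdef_mem; [definability|apply tdef_chain; definability].
  - apply cost_0. auto.
  - intros n Hn IH. apply cost_more; assumption.
Qed.

Lemma cost_nonneg (n x y a : M) : n ∈ omega -> cost n x y a -> zero R ≼ a.
Proof.
  intro Hn. revert n Hn x y a.
  apply (omega_ind (P := fun n => forall x y a, cost n x y a -> zero R ≼ a)).
  - unfold cost. do 3 apply fdef_all. apply fdef_imp; [|definability].
    apply fdef_mem; [definability|apply tdef_chain; definability].
  - intros x y a H. apply cost_0 in H. destruct H as (_ & _ & ->).
    apply (le_reflexive hR P0).
  - intros n Hn IH x y a H. apply (cost_S x y a Hn) in H.
    destruct H as [_ [H|(u & b & k & -> & H & Hk & _)]]; [eauto|].
    rewrite <- (sum_zero hR P0).
    apply (le_sum2 hR); eauto using scale_point, scale_nonneg.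
    apply (cost_dom Hn H).
Qed.

(** A chain of cost [a] has, for every threshold [t] up to [a], a step such that
    the chain costs at most [t] before it and at most [a - t] after it. *)
Lemma cost_split (n x y a t : M) :
  n ∈ omega -> cost (succ n) x y a -> t ∈ points R -> zero R ≼ t -> t ≼ a ->
  x = y \/ exists u v j a1 a2,
    cost n x u a1 /\ j ∈ omega /\ E j u v /\ cost n v y a2 /\
    a1 ≼ t /\ sum (R := R) a2 t ≼ a /\ h j ≼ a.
Proof.
  intros Hn H Ht H0 Hta. revert n Hn x y a H t Ht H0 Hta.
  apply (omega_ind (P := fun n => forall x y a, cost (succ n) x y a ->
    forall t, t ∈ points R -> zero R ≼ t -> t ≼ a ->
    x = y \/ exists u v j a1 a2,
      cost n x u a1 /\ j ∈ omega /\ E j u v /\ cost n v y a2 /\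
      a1 ≼ t /\ sum (R := R) a2 t ≼ a /\ h j ≼ a)).
  - unfold cost.
    assert (D : forall t u, tdef t -> tdef u -> fdef (fun e => t e ∈ chain (u e))).
    { intros t u Ht Hu. apply fdef_mem; [exact Ht|apply tdef_chain, Hu]. }
    do 3 apply fdef_all. apply fdef_imp; [apply D; definability|].
    apply fdef_all. do 3 (apply fdef_imp; [definability|]).
    apply fdef_or; [definability|]. do 5 apply fdef_ex.
    apply fdef_and; [apply D; definability|]. do 2 (apply fdef_and; [definability|]).
    apply fdef_and; [apply D; definability|definability].
  - intros x y a H t Ht H0 Hta. apply (cost_S x y a omega_0) in H.
    destruct H as [(Hx & Hy & Ha) [H|(u & b & k & -> & H & Hk & He)]].
    + left. apply cost_0 in H. tauto.
    + right. apply cost_0 in H. destruct H as (_ & <- & ->).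
      exists x, y, k, (zero R), (zero R). rewrite (zero_sum hR Ht).
      rewrite (zero_sum hR (scale_point Hk)) in *.
      split; [apply cost_0; auto|]. split; [exact Hk|]. split; [exact He|].
      split; [apply cost_0; auto|]. split; [exact H0|]. split; [exact Hta|].
      apply (le_reflexive hR Ha).
  - intros n Hn IH x y a H t Ht H0 Hta. pose proof (omega_S Hn) as HSn.
    apply (cost_S x y a HSn) in H.
    destruct H as [(Hx & Hy & Ha) [H|(y' & b & k & -> & H & Hk & He)]].
    + destruct (IH x y a H t Ht H0 Hta)
        as [A|(u & v & j & a1 & a2 & C1 & Hj & Eu & C2 & L)]; [auto|].
      right. exists u, v, j, a1, a2. auto 10 using cost_more.
    + pose proof (cost_dom HSn H) as (_ & Hy' & Hb).
      pose proof (scale_point Hk) as Hh.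
      assert (Lh : h k ≼ sum (R := R) b (h k)).
      { rewrite <- (zero_sum hR Hh) at 1.
        apply (le_sum hR); auto. apply (cost_nonneg HSn H). }
      right. destruct (classic (b ≼ t)) as [L|L].
      * exists y', y, k, b, (zero R). rewrite (zero_sum hR Ht).
        auto 8 using cost_refl.
      * apply (not_le_le hR Hb Ht) in L.
        destruct (IH x y' b H t Ht H0 L)
          as [->|(u & v & j & a1 & a2 & C1 & Hj & Eu & C2 & L1 & L2 & L3)].
        -- exists y', y, k, (zero R), (zero R). rewrite (zero_sum hR Ht).
           auto 8 using cost_refl.
        -- exists u, v, j, a1, (sum (R := R) a2 (h k)).
           destruct (cost_dom Hn C1) as (_ & _ & Pa1).
           destruct (cost_dom Hn C2) as (_ & _ & Pa2).
           pose proof (scale_point Hj) as Hhj.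
           split; [apply cost_more; assumption|]. split; [exact Hj|].
           split; [exact Eu|].
           split; [apply cost_add with (y := y'); assumption|].
           split; [exact L1|]. split.
           ++ rewrite (sum_assoc hR Pa2 Hh Ht), (sum_comm hR Hh Ht),
                <- (sum_assoc hR Pa2 Ht Hh).
              apply (le_sum hR); auto using sum_pt.
           ++ apply (le_trans hR) with (y := b); auto.
              rewrite <- (sum_zero hR Hb) at 1.
              apply (le_sum2 hR);
                auto using le_refl, scale_nonneg.
Qed.

(** Chains cheaper than [h k] stay inside the k-th entourage: cut the chain at
    half of its cost. *)
Lemma cost_entourage (n x y a k : M) :
  n ∈ omega -> cost n x y a -> k ∈ omega -> ~ h k ≼ a -> E k x y.
Proof.
  intros Hn H. revert k. revert n Hn x y a H.
  apply (omega_ind (P := fun n => forall x y a, cost n x y a ->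
    forall k, k ∈ omega -> ~ h k ≼ a -> E k x y)).
  - unfold cost. do 3 apply fdef_all. apply fdef_imp; [|definability].
    apply fdef_mem; [definability|apply tdef_chain; definability].
  - intros x y a H k Hk _. apply cost_0 in H. destruct H as (_ & <- & _).
    apply E_refl, Hk.
  - intros n Hn IH x y a H k Hk N. pose proof (omega_S Hn) as HSn.
    pose proof (omega_S Hk) as HSk.
    destruct (cost_dom HSn H) as (_ & _ & Ha).
    destruct (halving hR) as (half & _ & Hh). destruct (Hh a Ha) as [Ht Et].
    set (t := half a) in *.
    pose proof (cost_nonneg HSn H) as La.
    assert (H0 : zero R ≼ t).
    { apply (double_le hR P0 Ht). rewrite (sum_zero hR P0), Et. exact La. }
    assert (Hta : t ≼ a).
    { rewrite <- Et. rewrite <- (sum_zero hR Ht) at 1.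
      apply (le_sum2 hR); auto using le_refl. }
    assert (Nt : ~ h (succ k) ≼ t).
    { intro L. apply N. rewrite <- Et, <- (scale_double Hk).
      apply (le_sum2 hR); auto using scale_point. }
    destruct (cost_split Hn H Ht H0 Hta)
      as [->|(u & v & j & a1 & a2 & C1 & Hj & Eu & C2 & L1 & L2 & L3)];
      [apply E_refl, Hk|].
    destruct (cost_dom Hn C1) as (_ & _ & Pa1).
    destruct (cost_dom Hn C2) as (_ & _ & Pa2).
    apply E_cube with (y := u) (z := v); [exact Hk| | |].
    + apply (IH x u a1 C1 (succ k) HSk). intro L. apply Nt.
      apply (le_trans hR) with (y := a1); auto using scale_point.
    + apply (E_scale Hj Hk); [|exact Eu]. intro L. apply N.
      apply (le_trans hR) with (y := h j); auto using scale_point.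
    + apply (IH v y a2 C2 (succ k) HSk). intro L. apply Nt.
      apply (le_trans hR) with (y := a2); auto using scale_point.
      apply (le_cancel hR Pa2 Ht Ht). rewrite Et. exact L2.
Qed.

(** Some chain from [x] to [y] has total cost [a]. *)
Definition reach (x y a : M) : Prop := exists n, n ∈ omega /\ cost n x y a.

Lemma fdef_reach (t u v : env -> M) :
  tdef t -> tdef u -> tdef v -> fdef (fun e => reach (t e) (u e) (v e)).
Proof.
  apply fdef_lift3. unfold reach, cost. apply fdef_ex, fdef_and; [definability|].
  apply fdef_mem; [definability|apply tdef_chain; definability].
Qed.

Lemma reach_dom (x y a : M) : reach x y a -> x ∈ Y /\ y ∈ Y /\ a ∈ points R.
Proof. intros (n & Hn & H). apply (cost_dom Hn H). Qed.

Lemma reach_nonneg (x y a : M) : reach x y a -> zero R ≼ a.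
Proof. intros (n & Hn & H). apply (cost_nonneg Hn H). Qed.

Lemma reach_refl (x : M) : x ∈ Y -> reach x x (zero R).
Proof. intro Hx. exists empty. split; [apply omega_0|apply cost_0; auto]. Qed.

Lemma reach_add (x y z a k : M) :
  reach x y a -> k ∈ omega -> z ∈ Y -> E k y z ->
  reach x z (sum (R := R) a (h k)).
Proof.
  intros (n & Hn & H) Hk Hz He. exists (succ n).
  split; [apply omega_S, Hn|apply (cost_add Hn H Hk Hz He)].
Qed.

Lemma reach_edge (x y k : M) :
  k ∈ omega -> x ∈ Y -> y ∈ Y -> E k x y -> reach x y (h k).
Proof.
  intros Hk Hx Hy He. rewrite <- (zero_sum hR (scale_point Hk)).
  apply reach_add with (y := x); auto using reach_refl.
Qed.

Lemma reach_ind (Q : M -> M -> M -> Prop) :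
  fdef (fun e => Q (e 0) (e 1) (e 2)) ->
  (forall x, x ∈ Y -> Q x x (zero R)) ->
  (forall x y z a k, reach x y a -> Q x y a -> k ∈ omega -> z ∈ Y -> E k y z ->
     Q x z (sum (R := R) a (h k))) ->
  forall x y a, reach x y a -> Q x y a.
Proof.
  intros D H0 HS x y a (n & Hn & H). revert n Hn x y a H.
  apply (omega_ind (P := fun n => forall x y a, cost n x y a -> Q x y a)).
  - unfold cost. do 3 apply fdef_all. apply fdef_imp;
      [apply fdef_mem; [definability|apply tdef_chain; definability]|].
    apply (fdef_lift3 D); definability.
  - intros x y a H. apply cost_0 in H. destruct H as (Hx & <- & ->). auto.
  - intros n Hn IH x z c H. apply (cost_S x z c Hn) in H.
    destruct H as [(Hx & Hz & Hc) [H|(y & a & k & -> & H & Hk & He)]]; [auto|].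
    apply HS with (y := y); auto. exists n; auto.
Qed.

Lemma reach_trans (x y z a b : M) :
  reach x y a -> reach y z b -> reach x z (sum (R := R) a b).
Proof.
  intros Ha Hb. revert y z b Hb x a Ha.
  apply (reach_ind (Q := fun y z b =>
    forall x a, reach x y a -> reach x z (sum (R := R) a b))).
  - do 2 apply fdef_all. apply fdef_imp; apply fdef_reach; definability.
  - intros u Hu x a Ha. rewrite (sum_zero hR); [exact Ha|apply (reach_dom Ha)].
  - intros u v w c k Hc IH Hk Hw He x a Ha.
    rewrite <- (sum_assoc hR); [|apply (reach_dom Ha)|apply (reach_dom Hc)
      |apply scale_point, Hk].
    apply reach_add with (y := v); auto.
Qed.

Lemma reach_sym (x y a : M) : reach x y a -> reach y x a.
Proof.
  revert x y a. apply (reach_ind (Q := fun x y a => reach y x a)).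
  - apply fdef_reach; definability.
  - apply reach_refl.
  - intros u v w c k Hc IH Hk Hw He.
    destruct (reach_dom Hc) as (Hu & Hv & Pc).
    rewrite (sum_comm hR Pc (scale_point Hk)).
    apply reach_trans with (y := v); [|exact IH].
    apply reach_edge; auto.
Qed.

(** The infimum of the costs of the chains from [x] to [y], as the supremum of
    their lower bounds. *)
Definition dist (x y : M) : M :=
  the (is_sup R (sep (points R) (fun r => forall a, reach x y a -> r ≼ a))).

(** The lower bounds of the costs. *)
Lemma in_lower (x y r : M) :
  r ∈ sep (points R) (fun r => forall a, reach x y a -> r ≼ a) <->
  r ∈ points R /\ forall a, reach x y a -> r ≼ a.
Proof.
  rewrite in_sep; [reflexivity|]. apply fdef_all, fdef_imp; [|definability].
  apply fdef_reach; definability.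
Qed.

Lemma tdef_dist (t u : env -> M) :
  tdef t -> tdef u -> tdef (fun e => dist (t e) (u e)).
Proof.
  apply tdef_lift2. unfold dist. apply tdef_the.
  assert (D : forall i j k, fdef (fun e : env =>
    e i ∈ sep (points R) (fun r => forall a, reach (e j) (e k) a -> r ≼ a))).
  { intros i j k. apply fdef_mem; [definability|]. apply tdef_sep; [definability|].
    apply fdef_all, fdef_imp; [|definability]. apply fdef_reach; definability. }
  unfold is_sup, upper_bound. apply fdef_and; [apply fdef_and; [definability|]|].
  - apply fdef_all, fdef_imp; [apply D|definability].
  - apply fdef_all, fdef_imp; [|definability]. apply fdef_and; [definability|].
    apply fdef_all, fdef_imp; [apply D|definability].
Qed.

Lemma dist_spec (x y : M) :
  x ∈ Y -> y ∈ Y ->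
  dist x y ∈ points R /\ (forall a, reach x y a -> dist x y ≼ a) /\
  (forall r, r ∈ points R -> (forall a, reach x y a -> r ≼ a) -> r ≼ dist x y).
Proof.
  intros Hx Hy.
  set (L := sep (points R) (fun r => forall a, reach x y a -> r ≼ a)).
  assert (S : is_sup R L (dist x y)).
  { apply (the_spec (P := is_sup R L)). destruct (sup_complete hR (A := L)) as [s Hs].
    - intros r Hr. apply in_lower in Hr. tauto.
    - exists (zero R). apply in_lower. split; [exact P0|apply reach_nonneg].
    - exists (h empty). split; [apply scale_point, omega_0|].
      intros r Hr. apply in_lower in Hr. apply Hr.
      apply reach_edge; auto using omega_0.
    - exists s. split; [exact Hs|]. intros s' Hs'.
      destruct Hs as [U1 V1], Hs' as [U2 V2].
      apply (le_antisym hR); [apply U1|apply U2|apply V1, U2|apply V2, U1]. }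
  destruct S as [[Hs U] V]. split; [exact Hs|]. split.
  - intros a Ha. apply V. split; [apply (reach_dom Ha)|].
    intros r Hr. apply in_lower in Hr. apply Hr, Ha.
  - intros r Hr Hra. apply U, in_lower. auto.
Qed.

Lemma dist_point (x y : M) : x ∈ Y -> y ∈ Y -> dist x y ∈ points R.
Proof. intros Hx Hy. apply (dist_spec Hx Hy). Qed.

Lemma dist_nonneg (x y : M) : x ∈ Y -> y ∈ Y -> zero R ≼ dist x y.
Proof. intros Hx Hy. apply (dist_spec Hx Hy); [exact P0|apply reach_nonneg]. Qed.

Lemma dist_sym (x y : M) : dist x y = dist y x.
Proof.
  unfold dist. f_equal. f_equal. apply set_ext. intro r.
  rewrite !in_lower. split; intros [Hr H]; split; auto using reach_sym.
Qed.

Lemma dist_refl (x : M) : x ∈ Y -> dist x x = zero R.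
Proof.
  intro Hx. apply (le_antisym hR); auto using dist_point, dist_nonneg.
  apply (dist_spec Hx Hx), reach_refl, Hx.
Qed.

Lemma dist_triangle (x y z : M) :
  x ∈ Y -> y ∈ Y -> z ∈ Y -> dist x z ≼ sum (R := R) (dist x y) (dist y z).
Proof.
  intros Hx Hy Hz.
  pose proof (dist_point Hx Hz) as Pxz. pose proof (dist_point Hx Hy) as Pxy.
  pose proof (dist_point Hy Hz) as Pyz.
  (* Subtract first a cost b from y to z, then d(x, y). *)
  assert (A : forall b, reach y z b -> dist x z ≼ sum (R := R) (dist x y) b).
  { intros b Hb. destruct (reach_dom Hb) as (_ & _ & Pb).
    destruct (opposite hR Pb) as (o & Po & Eo).
    assert (K : sum (R := R) (dist x z) o ≼ dist x y).
    { apply (dist_spec Hx Hy); [apply (sum_point hR); assumption|].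
      intros a Ha. destruct (reach_dom Ha) as (_ & _ & Pa).
      rewrite <- (sum_zero hR Pa), <- Eo, <- (sum_assoc hR Pa Pb Po).
      apply (le_sum hR); auto using sum_pt.
      apply (dist_spec Hx Hz), (reach_trans Ha Hb). }
    apply (le_sum hR) with (z := b) in K; auto using sum_pt.
    rewrite (sum_assoc hR Pxz Po Pb), (sum_comm hR Po Pb), Eo, (sum_zero hR Pxz) in K.
    exact K. }
  destruct (opposite hR Pxy) as (o & Po & Eo).
  assert (K : sum (R := R) o (dist x z) ≼ dist y z).
  { apply (dist_spec Hy Hz); [apply (sum_point hR); assumption|].
    intros b Hb. destruct (reach_dom Hb) as (_ & _ & Pb).
    rewrite <- (zero_sum hR Pb), <- Eo, (sum_comm hR Pxy Po), (sum_assoc hR Po Pxy Pb).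
    apply (le_sum2 hR); auto using sum_pt, le_refl. }
  pose proof (le_sum2 hR Pxy Pxy (sum_pt Po Pxz) Pyz (le_refl Pxy) K) as K'.
  rewrite <- (sum_assoc hR Pxy Po Pxz), Eo, (zero_sum hR Pxz) in K'. exact K'.
Qed.

Lemma dist_le_scale (x y k : M) :
  k ∈ omega -> x ∈ Y -> y ∈ Y -> E k x y -> dist x y ≼ h k.
Proof. intros Hk Hx Hy He. apply (dist_spec Hx Hy), reach_edge; assumption. Qed.

Lemma dist_lt_scale (x y k : M) :
  k ∈ omega -> x ∈ Y -> y ∈ Y -> ~ h k ≼ dist x y -> E k x y.
Proof.
  intros Hk Hx Hy N. apply NNPP. intro NE. apply N.
  apply (dist_spec Hx Hy); [apply scale_point, Hk|].
  intros a (n & Hn & Ha). apply NNPP. intro L. apply NE.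
  apply (cost_entourage Hn Ha Hk L).
Qed.

(** A decreasing sequence of symmetric entourages, each of whose members is a
    cube root of the preceding one, and which separates points, comes from a
    metric: the balls of radius [h k] are comparable with the k-th entourage. *)
Lemma metrization :
  (forall x y, x ∈ Y -> y ∈ Y -> x <> y -> exists k, k ∈ omega /\ ~ E k x y) ->
  exists d, metric R Y d /\
    forall x y, x ∈ Y -> y ∈ Y -> exists r, app2 d x y r /\ r ∈ points R /\
      (forall r', app2 d x y r' -> r' = r) /\
      forall k, k ∈ omega -> (~ h k ≼ r -> E k x y) /\ (E k x y -> r ≼ h k).
Proof.
  intro E_sep.
  set (d := sep (prod (prod Y Y) (points R))
              (fun q => exists x y, q = opair (opair x y) (dist x y))).
  assert (Hin : forall q, q ∈ d <-> q ∈ prod (prod Y Y) (points R) /\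
    exists x y, q = opair (opair x y) (dist x y)).
  { intro q. unfold d. rewrite in_sep; [reflexivity|].
    do 2 apply fdef_ex. apply fdef_eq; [definability|].
    apply tdef_opair; [definability|apply tdef_dist; definability]. }
  assert (Hd : forall x y r, app2 d x y r <-> x ∈ Y /\ y ∈ Y /\ r = dist x y).
  { intros x y r. rewrite app2_opair, Hin, !opair_prod. split.
    - intros (((Hx & Hy) & _) & x' & y' & Eq).
      apply opair_inj in Eq. destruct Eq as [Eq ->].
      apply opair_inj in Eq. destruct Eq; subst; auto.
    - intros (Hx & Hy & ->). split; [auto using dist_point|]. exists x, y; auto. }
  exists d. split.
  - constructor.
    + exists (prod Y Y). split; [apply is_product_eq; reflexivity|]. split; [split|].
      * intros p Hp. apply Hin in Hp. destruct Hp as [Hp _].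
        apply in_prod in Hp. destruct Hp as (q & r & Hq & Hr & Ep).
        exists q, r. split; [exact Hq|apply is_opair_eq, Ep].
      * intros q Hq. apply in_prod in Hq. destruct Hq as (x & y & Hx & Hy & ->).
        exists (dist x y). split.
        -- apply app_opair, app2_opair, Hd. auto.
        -- intros r Hr. apply app_opair, app2_opair, Hd in Hr.
           symmetry; tauto.
      * intros q r Hr. apply app_opair, Hin in Hr. rewrite opair_prod in Hr. tauto.
    + intros x y r H. apply Hd in H. destruct H as (Hx & Hy & ->).
      apply dist_nonneg; assumption.
    + intros x y r H. apply Hd in H. destruct H as (Hx & Hy & ->). split.
      * intro Z. apply NNPP. intro N. destruct (E_sep x y Hx Hy N) as (k & Hk & NE).
        apply NE, dist_lt_scale; try assumption. rewrite Z. apply h_spec, Hk.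
      * intros <-. apply dist_refl, Hx.
    + intros x y r H. apply Hd in H. destruct H as (Hx & Hy & ->).
      apply Hd. auto using dist_sym.
    + intros x y z r s t u H1 H2 H3 H4. apply Hd in H1, H2, H3.
      destruct H1 as (Hx & Hz & ->), H2 as (_ & Hy & ->), H3 as (_ & _ & ->).
      apply (app2_sum hR) in H4. subst u. apply dist_triangle; assumption.
  - intros x y Hx Hy. exists (dist x y). split; [apply Hd; auto|].
    split; [apply dist_point; assumption|]. split.
    + intros r' H. apply Hd in H. tauto.
    + intros k Hk. split; [apply dist_lt_scale|apply dist_le_scale]; assumption.
Qed.

End Metrization.
Theorem corollary2p8 (M : structure) (hM : ZF M)
    (R : ordered_structure M) (hR : complete_ordered_field R)
    (X T P S : M)
    (hT : topology X T)
    (hH : hausdorff X T)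
    (hL : locally_compact X T)
    (hB : has_cuf_base T)
    (hP : G_delta X T P)
    (hS : is_subspace_topology T P S) :
  cantor_completely_metrizable R P S.
Proof.
  destruct hB as (B & hBT & hcuf).
  destruct (cuf_filtration hcuf) as (beta & bd & bfin & bsub & bmono & bcov).
  destruct (G_delta_sequence hT hP) as (g & gd & gopen & Peq).
  destruct (halving_sequence hR) as (h & hd & hspec & harch).
  set (E := entourage (T := T) beta g).
  assert (PX : P ⊆ X).
  { intros x Hx. apply (topology_sub hT (gopen empty)), Peq; [exact Hx|apply omega_0]. }
  assert (Edef : fdef (fun e => E (e 0) (e 1) (e 2)))
    by exact (entourage_def bd gd).
  assert (Erefl : forall k x, k ∈ omega -> E k x x)
    by exact (entourage_refl hT hH hL hBT bd bfin bsub bmono bcov gd gopen).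
  assert (Ecube : forall k x y z w, k ∈ omega ->
    E (succ k) x y -> E (succ k) y z -> E (succ k) z w -> E k x w)
    by exact (entourage_cube hT hH hL hBT bd bfin bsub bmono bcov gd gopen).
  assert (Eopen : forall k x, k ∈ omega -> x ∈ P ->
    exists O, O ∈ T /\ x ∈ O /\ forall y, y ∈ O -> E k x y)
    by exact (entourage_open hT hH hL hBT bd bfin bsub bmono bcov gd gopen Peq).
  assert (Esmall : forall O x, O ∈ T -> x ∈ O ->
    exists k, k ∈ omega /\ forall y, E k x y -> y ∈ O)
    by exact (entourage_small hT hH hL hBT bd bsub bmono bcov gd).
  assert (Ecompact : forall n x, n ∈ omega -> x ∈ P ->
    exists V, way_below T V (g n) /\ forall y, E (succ n) x y -> y ∈ V)
    by exact (entourage_compact hT hH hL hBT bd bfin bsub bmono bcov gd gopen Peq).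
  assert (Esep : forall x y, x ∈ P -> y ∈ P -> x <> y ->
    exists k, k ∈ omega /\ ~ E k x y).
  { intros x y Hx Hy N.
    destruct (hH x y (PX x Hx) (PX y Hy) N) as (U & V & HU & HV & xU & yV & dis).
    destruct (Esmall U x HU xU) as (k & Hk & K). exists k. split; [exact Hk|].
    intro A. apply (dis y). auto. }
  destruct (metrization hR hd hspec (Y := P) Edef
    (entourage_0 bd gd) Erefl
    (@entourage_sym _ _ T beta g) Ecube Esep) as (d & Hd & dspec).
  pose proof (zero_point hR) as P0.
  assert (hpt : forall k, k ∈ omega -> h k ∈ points R) by apply hspec.
  assert (hpos : forall k, k ∈ omega -> lt R (zero R) (h k)).
  { intros k Hk. apply (lt_not_le hR P0 (hpt k Hk)). apply hspec, Hk. }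
  (* The metric induces the subspace topology. *)
  assert (Htop : is_metric_topology R P d S).
  { intro U. rewrite (hS U). split.
    - intros (O & HO & EU). apply is_inter_eq in EU; subst U.
      split; [intros x Hx; apply in_cap in Hx; tauto|].
      intros x Hx. apply in_cap in Hx. destruct Hx as [xO xP].
      destruct (Esmall O x HO xO) as (k & Hk & K).
      exists (h k). split; [apply hpt, Hk|]. split; [apply hpos, Hk|].
      intros y r Hy Hr L. apply in_cap. split; [|exact Hy].
      destruct (dspec x y xP Hy) as (r' & _ & Pr & U & D).
      apply U in Hr; subst r'. apply K, (D k Hk).
      apply (lt_not_le hR Pr (hpt k Hk)), L.
    - intros [UP HU].
      set (C := sep T (fun V => cap V P ⊆ U)).
      assert (HC : forall V, V ∈ C <-> V ∈ T /\ cap V P ⊆ U).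
      { intro V. unfold C. rewrite in_sep by definability. reflexivity. }
      exists (bigcup C). split.
      { apply (open_bigcup hT). intros V HV. apply HC in HV; tauto. }
      apply is_inter_eq, set_ext. intro x. rewrite in_cap, in_bigcup. split.
      + intro xU. split; [|apply UP, xU].
        destruct (HU x xU) as (eps & Heps & Leps & K).
        destruct (harch eps Heps) as (k & Hk & Nk);
          [apply (lt_not_le hR P0 Heps), Leps|].
        destruct (Eopen k x Hk (UP x xU)) as (O & HO & xO & KO).
        exists O. split; [|exact xO]. apply HC. split; [exact HO|].
        intros y Hy. apply in_cap in Hy. destruct Hy as [yO yP].
        destruct (dspec x y (UP x xU) yP) as (r & Hr & Pr & _ & D).
        apply (K y r yP Hr). apply (lt_not_le hR Pr Heps). intro L.
        apply Nk. apply (le_trans hR) with (y := r); auto.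
        apply (D k Hk), KO, yO.
      + intros [(V & HV & xV) xP]. apply HC in HV. destruct HV as [_ HV].
        apply HV, in_cap; auto. }
  exists d. split; [exact Hd|]. split; [|exact Htop].
  (* Completeness: the sets F_n are eventually contained in compact subsets of
     each g_n, hence accumulate at a point of P. *)
  intros T' w F HT' Hw [Fdom Ftot] Fclosed Fdesc Fsmall.
  apply is_omega_eq in Hw; subst w.
  assert (T' = S) as ->.
  { apply set_ext. intro U. rewrite (HT' U), (Htop U). reflexivity. }
  assert (Fnum : forall n A, app F n A -> n ∈ omega).
  { intros n A H. apply app_opair in H. destruct (Fdom _ H) as (m & A' & Hm & Eq).
    apply is_opair_eq, opair_inj in Eq. destruct Eq; subst; exact Hm. }
  assert (FP : forall n A, app F n A -> A ⊆ P).
  { intros n A H. apply (Fclosed n A H). }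
  assert (Fdir : forall n A m B', app F n A -> app F m B' ->
    exists l C, app F l C /\ C ⊆ A /\ C ⊆ B').
  { intros n A m B' HA HB'.
    destruct (omega_trichotomy (Fnum n A HA) (Fnum m B' HB')) as [L|[L|L]].
    - exists m, B'. split; [exact HB'|]. split; [apply (Fdesc n m); auto|].
      intros x Hx; exact Hx.
    - subst m. destruct (Ftot n (Fnum n A HA)) as (C & HC & U).
      assert (C = A) by (apply U, HA). assert (C = B') by (apply U, HB').
      exists n, C. subst. split; [exact HC|]. split; intros x Hx; exact Hx.
    - exists n, A. split; [exact HA|]. split; [intros x Hx; exact Hx|].
      apply (Fdesc m n); auto. }
  assert (Fent : forall k, k ∈ omega ->
    exists n A, app F n A /\ forall x y, x ∈ A -> y ∈ A -> E k x y).
  { intros k Hk. destruct (Fsmall (h k) (hpt k Hk) (hpos k Hk)) as (N & HN & K).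
    destruct (Ftot N HN) as (A & HA & _). exists N, A. split; [exact HA|].
    destruct (K N A HA (or_introl eq_refl)) as (s & (D & HD & [[Ps U] _]) & L).
    intros x y Hx Hy.
    destruct (dspec x y (FP N A HA x Hx) (FP N A HA y Hy)) as (r & Hr & Pr & _ & De).
    apply (De k Hk). intro L'.
    apply (lt_not_le hR Ps (hpt k Hk)) in L. apply L.
    apply (le_trans hR) with (y := r); auto.
    apply U, HD. exists x, y. auto. }
  assert (Fcompact : forall j, j ∈ omega -> exists n A K,
    app F n A /\ ideal_compact T K /\ A ⊆ K /\ K ⊆ g j).
  { intros j Hj. destruct (Fent (succ j) (omega_S Hj)) as (n & A & HA & K).
    destruct (Fclosed n A HA) as [_ [a Ha]].
    destruct (Ecompact j a Hj (FP n A HA a Ha)) as (V & (C & HC & VC & CV) & HV).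
    exists n, A, C. split; [exact HA|]. split; [exact HC|]. split; [|exact CV].
    intros y Hy. apply VC, HV, K; assumption. }
  assert (Acc : exists p, p ∈ X /\ forall O, O ∈ T -> p ∈ O ->
    forall n A, app F n A -> exists z, z ∈ O /\ z ∈ A).
  { destruct (Fcompact empty omega_0) as (n0 & A0 & K0 & HA0 & HK0 & AK & KG).
    apply NNPP. intro N.
    set (J := sep T (fun V => exists n A, app F n A /\ forall z, ~ (z ∈ V /\ z ∈ A))).
    assert (HJ : forall V, V ∈ J <->
      V ∈ T /\ exists n A, app F n A /\ forall z, ~ (z ∈ V /\ z ∈ A)).
    { intro V. unfold J. rewrite in_sep by definability. reflexivity. }
    destruct (HK0 J) as (V & HV & KV).
    - intros V HV. apply HJ in HV; tauto.
    - apply HJ. split; [apply (open_empty hT)|]. exists n0, A0.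
      split; [exact HA0|]. intros z [Hz _]. apply (in_empty Hz).
    - intros V V' HV HV'. apply HJ in HV, HV'.
      destruct HV as (HV & n & A & HA & dis), HV' as (HV' & n' & A' & HA' & dis').
      apply HJ. split; [apply (open_cup hT); assumption|].
      destruct (Fdir n A n' A' HA HA') as (l & C & HC & CA & CA').
      exists l, C. split; [exact HC|]. intros z [Hz zC]. apply in_cup in Hz.
      destruct Hz as [Hz|Hz]; [apply (dis z)|apply (dis' z)]; auto.
    - intros x Hx. apply NNPP. intro NC. apply N. exists x.
      split; [apply (topology_sub hT (gopen empty)), KG, Hx|].
      intros O HO xO n A HA. apply NNPP. intro Nz. apply NC. exists O.
      split; [|exact xO]. apply HJ. split; [exact HO|]. exists n, A.
      split; [exact HA|]. intros z Hz. apply Nz. exists z; exact Hz.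
    - apply HJ in HV. destruct HV as (_ & n & A & HA & dis).
      destruct (Fdir n A n0 A0 HA HA0) as (l & C & HC & CA & CA0).
      destruct (Fclosed l C HC) as [_ [z Hz]]. apply (dis z). auto. }
  destruct Acc as (p & pX & Hp).
  assert (pP : p ∈ P).
  { apply Peq. intros j Hj.
    destruct (Fcompact j Hj) as (n & A & K & HA & HK & AK & KG).
    apply KG, NNPP. intro N.
    destruct (@separate_compact _ _ X T K p hT hH HK) as (O & W & HO & _ & pO & KW & dis);
      try assumption.
    - intros x Hx. apply (topology_sub hT (gopen j)), KG, Hx.
    - destruct (Hp O HO pO n A HA) as (z & zO & zA). apply (dis z). auto. }
  exists p. intros n A HA. apply NNPP. intro N.
  destruct (Fclosed n A HA) as [[_ (U & HU & US)] _].
  apply is_diff_eq in HU. apply hS in US. destruct US as (O & HO & EO).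
  apply is_inter_eq in EO.
  assert (Heq : forall x, x ∈ O /\ x ∈ P <-> x ∈ P /\ ~ x ∈ A).
  { intro x. rewrite <- in_cap, <- in_diff, <- EO, <- HU. reflexivity. }
  assert (pO : p ∈ O) by (apply Heq; auto).
  destruct (Hp O HO pO n A HA) as (z & zO & zA).
  apply (Heq z); [split; [exact zO|apply (FP n A HA z zA)]|exact zA].
Qed.
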